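(* For every integer $K_1\ge1$, the class $\overrightarrow{\mathcal A}^\infty_{K_1,\infty,\infty,\infty}$ of free orderings of members of $\mathcal A^\infty_{K_1,\infty,\infty,\infty}$ is Ramsey and has the expansion property.
   Context: For an integer $K_1\ge1$, $\mathcal A^\infty_{K_1,\infty,\infty,\infty}$ is the class of all finite metric spaces with positive integer distances containing no triangle of odd perimeter $p<2K_1+1$. A free ordering is an expansion by an arbitrary linear order. A class $\mathcal C$ is Ramsey if for all $\mathbf A,\mathbf B\in\mathcal C$ and $k\ge1$ there is $\mathbf C\in\mathcal C$ such that for every $k$-colouring of the copies of $\mathbf A$ in $\mathbf C$ some copy of $\mathbf B$ in $\mathbf C$ has all its copies of $\mathbf A$ of one colour. A class $\mathcal K^+$ of expansions of $\mathcal K$ has the expansion property if for every $\mathbf A\in\mathcal K$ there is $\mathbf B\in\mathcal K$ such that every expansion of $\mathbf A$ in $\mathcal K^+$ embeds into every expansion of $\mathbf B$ in $\mathcal K^+$. *)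

(* Defs.v *)
From mathcomp Require Export all_boot.
Set Implicit Arguments.
Unset Strict Implicit.
Unset Printing Implicit Defensive.

Record dist_struct := DistStruct {
  carrier :> finType;
  dist : carrier -> carrier -> nat
}.

Definition is_metric (X : dist_struct) : Prop :=
  [/\ forall x y : X, dist x y = 0 <-> x = y,
      forall x y : X, dist x y = dist y x
    & forall x y z : X, dist x z <= dist x y + dist y z].

Definition perimeter (X : dist_struct) (x y z : X) : nat :=
  dist x y + dist y z + dist z x.

Definition no_short_odd_triangle (K1 : nat) (X : dist_struct) : Prop :=
  forall x y z : X, x != y -> y != z -> z != x ->
    ~ (odd (perimeter x y z) /\ perimeter x y z < 2 * K1 + 1).

Definition class_A (K1 : nat) (X : dist_struct) : Prop :=
  is_metric X /\ no_short_odd_triangle K1 X.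

Record ord_struct := OrdStruct {
  reduct :> dist_struct;
  ord : rel reduct
}.

Definition linear_order (T : Type) (r : rel T) : Prop :=
  [/\ reflexive r, antisymmetric r, transitive r & total r].

Definition free_orderings (K : dist_struct -> Prop) (X : ord_struct) : Prop :=
  K (reduct X) /\ linear_order (ord (o := X)).

Definition embedding (A B : ord_struct) (f : A -> B) : Prop :=
  [/\ injective f,
      forall x y : A, dist (f x) (f y) = dist x y
    & forall x y : A, ord (f x) (f y) = ord x y].

(* A copy of A in C is a substructure of C isomorphic to A, represented by its
   set of vertices. *)
Definition is_copy (A C : ord_struct) (S : {set C}) : Prop :=
  exists2 f : A -> C, embedding f & S = f @: [set: A].

(* The colouring chi is defined on all subsets of C, but only its values on
   copies of A are used; as k > 0, every colouring of the copies extends. *)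
Definition ramsey_class (K : ord_struct -> Prop) : Prop :=
  forall A B : ord_struct, K A -> K B ->
  forall k : nat, 0 < k ->
  exists2 C : ord_struct, K C &
    forall chi : {set C} -> 'I_k,
    exists2 SB : {set C}, is_copy B SB &
      exists c : 'I_k, forall SA : {set C},
        is_copy A SA -> SA \subset SB -> chi SA = c.

Definition expansion_property (K : dist_struct -> Prop)
    (Kplus : ord_struct -> Prop) : Prop :=
  forall A : dist_struct, K A ->
  exists2 B : dist_struct, K B &
    forall (rA : rel A) (rB : rel B),
      Kplus (OrdStruct rA) -> Kplus (OrdStruct rB) ->
      exists f : OrdStruct rA -> OrdStruct rB, embedding f.

(* Main.v *)
Require Import Defs.
From mathcomp Require Import zify.

(* Parity-graded distances (the length of a shortest even, resp. odd, walk) turn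
   a member of the class into a metric on its double cover; the condition on odd
   triangles says that the two lifts of a point are at distance at least
   2 K1 + 1.  A finite member embeds in a power of a finite set of letters through
   its parity-respecting 1-Lipschitz functions ("columns"), a Kuratowski embedding
   for the sup distance, and the space of all words of length n with this distance
   is again in the class.  A map collapsing n coordinates to the columns of B gives
   a copy of B in the word space, and the Graham-Rothschild theorem on parameter
   words makes all copies of A obtained by restricting columns monochromatic.  For
   this the restriction of columns from B to A must respect the order of first
   occurrences: columns are compared through their generators, the points where
   the value is not forced by the others, and the cone extension of a column is the
   least of all its extensions in this order.
   The expansion property follows by applying the Ramsey property to pairs of
   points at one large distance, in a structure where any two points of a copy of A
   are separated in the order by a point far from both. *)

Set Implicit Arguments.
Unset Strict Implicit.
Unset Printing Implicit Defensive.

(** * Parameter words *)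

(* [pw s t w]: the letters below s are constants, the parameters s, ..., t - 1
   all occur in w, and their first occurrences come in increasing order. *)
Fixpoint pw (s t : nat) (w : seq nat) : bool :=
  if w is l :: w' then
    if l < s then pw s t w' else (l == s) && pw s.+1 t w'
  else s == t.

Definition wsubst s (g w : seq nat) : seq nat :=
  [seq if l < s then l else nth 0 g (l - s) | l <- w].

Definition shift s m (w : seq nat) : seq nat :=
  [seq if l < s then l else l + m | l <- w].

Definition letters s (w : seq nat) := all (fun l => l < s) w.

Lemma size_wsubst s g w : size (wsubst s g w) = size w.
Proof. exact: size_map. Qed.

Lemma size_shift s m w : size (shift s m w) = size w.
Proof. exact: size_map. Qed.

Lemma wsubst_cat s g w1 w2 : wsubst s g (w1 ++ w2) = wsubst s g w1 ++ wsubst s g w2.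
Proof. exact: map_cat. Qed.

Lemma pw_le s t w : pw s t w -> s <= t.
Proof.
elim: w s => [|l w IH] s /=; first by move/eqP->.
by case: ltnP => _; [exact: IH | case/andP=> _ /IH /ltnW].
Qed.

Lemma pw_letters s t w : pw s t w -> letters t w.
Proof.
elim: w s => [|l w IH] s //=.
case: ltnP => [ls pww|_ /andP[/eqP-> pww]].
  by rewrite (leq_trans ls (pw_le pww)) (IH _ pww).
by rewrite (pw_le pww) (IH _ pww).
Qed.

Lemma pw_id s w : pw s s w = letters s w.
Proof.
elim: w => [|l w IH] /=; first by rewrite eqxx.
case: ltnP => //= _; apply/negP => /andP[_ /pw_le]; by rewrite ltnn.
Qed.

Lemma pw_cat s t v w1 w2 : pw s t w1 -> pw t v w2 -> pw s v (w1 ++ w2).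
Proof.
elim: w1 s => [|l w IH] s /=; first by move/eqP->.
case: ltnP => _; first exact: IH.
by case/andP=> -> /= /IH; apply.
Qed.

Lemma pw_shift s t m w : pw s t w -> pw (s + m) (t + m) (shift s m w).
Proof.
have gen c : s <= c -> pw c t w -> pw (c + m) (t + m) (shift s m w).
  elim: w c => [|l w IH] c sc /=; first by move/eqP->.
  case: (ltnP l c) => lc.
    by move=> pww; case: (ltnP l s) => ls; (rewrite ifT; [exact: IH | lia]).
  case/andP=> /eqP lE pww; have -> : (l < s) = false by lia.
  rewrite lE ltnn eqxx /=.
  by rewrite -addSn; apply: IH => //; lia.
exact: gen.
Qed.

Lemma pw_wsubst s t v g w :
  pw s t w -> size g = t - s -> pw s v g -> pw s v (wsubst s g w).
Proof.
(* Invariant while reading [w]: [g1] holds the letters of [g] for the parameters met so far, [v'] is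
   the next fresh parameter of [g]; a first occurrence in [w] moves one letter from [g2] to [g1]. *)
have gen c v' g1 g2 : s <= c -> pw c t w -> size (g1 ++ g2) = t - s ->
    size g1 = c - s -> pw s v' g1 -> pw v' v g2 ->
    pw v' v (wsubst s (g1 ++ g2) w).
  elim: w c v' g1 g2 => [|l w IH] c v' g1 g2 sc /=.
    move/eqP=> ct; rewrite size_cat => sg sg1 _.
    by have -> : g2 = [::] by apply/size0nil; lia.
  case: (ltnP l c) => lc.
    move=> pww sg sg1 pg1 pg2; rewrite ifT; first exact: (IH c).
    case: (ltnP l s) => ls; first exact: leq_trans ls (pw_le pg1).
    rewrite nth_cat sg1 ifT; last by lia.
    have /allP lg1 := pw_letters pg1.
    by apply: lg1; apply: mem_nth; rewrite sg1; lia.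
  case/andP=> /eqP-> pww sg sg1 pg1 pg2.
  have -> : (c < s) = false by lia.
  rewrite nth_cat sg1 ltnn subnn.
  case: g2 sg pg2 => [|b g2] /=.
    by rewrite cats0 sg1; move: (pw_le pww); lia.
  move=> sg; have E : g1 ++ b :: g2 = rcons g1 b ++ g2 by rewrite cat_rcons.
  case: (ltnP b v') => bv.
    move=> pg2; rewrite E; apply: (IH c.+1) => //; first by lia.
    - by rewrite -E.
    - by rewrite size_rcons sg1; lia.
    - by rewrite -cats1; apply: pw_cat pg1 _; rewrite /= bv.
  case/andP=> /eqP bE pg2; rewrite bE eqxx /= -bE E.
  apply: (IH c.+1) => //; first by lia.
  - by rewrite -E.
  - by rewrite size_rcons sg1; lia.
  - by rewrite bE -cats1; apply: pw_cat pg1 _; rewrite /= ltnn eqxx /=.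
  - by rewrite bE.
move=> pww sg pg; apply: (gen s s [::] g) => //=; by rewrite subnn.
Qed.

Lemma wsubst_sub s h g w : letters (s + size g) w ->
  wsubst s h (wsubst s g w) = wsubst s (wsubst s h g) w.
Proof.
move=> /allP lw; rewrite /wsubst -map_comp; apply/eq_in_map => l /lw /= ll.
case: (ltnP l s) => ls; first by rewrite ls.
by rewrite (nth_map 0) //; lia.
Qed.

Lemma wsubst_id s g w : letters s w -> wsubst s g w = w.
Proof.
by move=> /allP lw; rewrite -[RHS]map_id; apply/eq_in_map => l /lw ->.
Qed.

Lemma wsubst_shift_cat s m g1 g2 w : size g1 = m ->
  wsubst s (g1 ++ g2) (shift s m w) = wsubst s g2 w.
Proof.
move=> sg; rewrite /wsubst /shift -map_comp; apply/eq_map => l /=.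
case: (ltnP l s) => ls; first by rewrite ls.
have -> : (l + m < s) = false by lia.
rewrite nth_cat sg; have -> : (l + m - s < m) = false by lia.
by congr nth; lia.
Qed.

Lemma wsubst_cat_letters s m g1 g2 w : size g1 = m -> letters (s + m) w ->
  wsubst s (g1 ++ g2) w = wsubst s g1 w.
Proof.
move=> sg /allP lw; apply/eq_in_map => l /lw /= ll.
by case: (ltnP l s) => // ls; rewrite nth_cat sg ifT //; lia.
Qed.

Lemma letters_wsubst s v g w : s <= v -> letters (s + size g) w -> letters v g ->
  letters v (wsubst s g w).
Proof.
move=> sv /allP lw /allP lg; apply/allP => _ /mapP[l /lw /= ll ->].
case: (ltnP l s) => ls; first exact: leq_trans ls sv.
by apply/lg/mem_nth; rewrite -subSn // leq_subLR.
Qed.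

Lemma letters_nseq s n x : x < s -> letters s (nseq n x).
Proof. by move=> xs; rewrite /letters all_nseq xs orbT. Qed.

(* Colouring by functions of a word of fixed length makes the colour
   independent of a suffix uniformly over all prefixes. *)
Definition encode_prefix (K : finType) s n (f : seq nat -> K) :
    {ffun n.-tuple 'I_s.+1 -> K} :=
  [ffun p : n.-tuple 'I_s.+1 => f [seq val i | i <- p]].

Lemma encode_prefix_eq (K : finType) s n (f f' : seq nat -> K) :
  encode_prefix s n f = encode_prefix s n f' ->
  forall p, size p = n -> letters s.+1 p -> f p = f' p.
Proof.
move=> E p sp lp.
have st : size [seq inord l : 'I_s.+1 | l <- p] == n by rewrite size_map sp.
have := congr1 (fun F : {ffun _ -> K} => F (Tuple st)) E; rewrite !ffunE /=.
have -> : [seq val i | i <- [seq inord l : 'I_s.+1 | l <- p]] = p.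
  rewrite -map_comp -[RHS]map_id; apply/eq_in_map => l /(allP lp) ll /=.
  by rewrite inordK.
by [].
Qed.

(** * The Hales-Jewett theorem, by Shelah's cube argument *)

Definition hales_jewett_line s := forall K : finType, exists n,
  forall chi : seq nat -> K, exists L, [/\ size L = n, pw s s.+1 L
    & forall x y, x < s -> y < s -> chi (wsubst s [:: x] L) = chi (wsubst s [:: y] L)].

Lemma pw_line s L : pw s s.+1 L -> forall m, pw (s + m) (s + m.+1) (shift s m L).
Proof. by move=> pL m; rewrite addnS -addSn; apply: pw_shift. Qed.

(* Pigeonhole on the words a^j b^(N-j). *)
Lemma pigeonhole_line s (K : finType) : exists n, forall chi : seq nat -> K,
  exists L, [/\ size L = n, pw s.+2 s.+3 L
    & chi (wsubst s.+2 [:: s.+1] L) = chi (wsubst s.+2 [:: s] L)].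
Proof.
(* The words [W j] outnumber the colours, so two of them share a colour; the positions where they
   differ carry the parameter. *)
exists #|K| => chi; set n := #|K|.
pose W (j : 'I_n.+1) := nseq j s.+1 ++ nseq (n - j) s.
have [inj|] := boolP (injectiveb (fun j => chi (W j))).
  by have := leq_card _ (injectiveP _ inj); rewrite card_ord ltnn.
case/injectivePn => i [j ne E].
wlog lij : i j ne E / i < j.
  move=> H; case: (ltngtP i j) => [ij|ji|/val_inj e]; first exact: (H i j).
    by apply: (H j i) => //; rewrite eq_sym.
  by rewrite e eqxx in ne.
have jn : j <= n by rewrite -ltnS.
exists (nseq i s.+1 ++ nseq (j - i) s.+2 ++ nseq (n - j) s); split.
- by rewrite !size_cat !size_nseq; lia.
- apply: (@pw_cat _ s.+2); first by rewrite pw_id letters_nseq //; lia.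
  apply: (@pw_cat _ s.+3); last by rewrite pw_id letters_nseq //; lia.
  have -> : j - i = (j - i).-1.+1 by lia.
  by rewrite /= ltnn eqxx /= pw_id letters_nseq //; lia.
- have S x : wsubst s.+2 [:: x] (nseq i s.+1 ++ nseq (j - i) s.+2 ++ nseq (n - j) s)
     = nseq i s.+1 ++ nseq (j - i) x ++ nseq (n - j) s.
    by rewrite !wsubst_cat /wsubst !map_nseq !ltnS !leqnn ltnn subnn leqnSn.
  have Wj : nseq i s.+1 ++ nseq (j - i) s.+1 ++ nseq (n - j) s = W j.
    by rewrite catA -nseqD subnKC // ltnW.
  have Wi : nseq i s.+1 ++ nseq (j - i) s ++ nseq (n - j) s = W i.
    by rewrite /W -nseqD; congr (_ ++ nseq _ _); lia.
  by rewrite !S Wj Wi.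
Qed.

Lemma pw_mem s t w l : pw s t w -> s <= l < t -> l \in w.
Proof.
elim: w s => [|a w IH] s /=; first by move/eqP->; lia.
rewrite inE; case: ltnP => [_ pww lst|_ /andP[/eqP-> pww] lst].
  by rewrite (IH s) ?orbT.
by case: eqVneq => //= ne; apply: (IH s.+1) => //; lia.
Qed.

Lemma pw_before s t w l : pw s t w -> s <= l ->
  letters l (take (index l w) w).
Proof.
elim: w s => [|a w IH] s //=.
case: ltnP => [las pww sl|_ /andP[/eqP-> pww] sl].
  have -> : (a == l) = false by apply/eqP; lia.
  by rewrite /= (leq_trans las sl) (IH s).
case: eqVneq => //= ne; rewrite (IH s.+1) ?andbT //; lia.
Qed.

Lemma pw_split s t w : pw s t w -> s < t ->
  exists p q, [/\ w = p ++ s :: q, letters s p & pw s.+1 t q].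
Proof.
elim: w => [|a w IH] /=; first by move/eqP->; rewrite ltnn.
case: ltnP => [las pww st|_ /andP[/eqP-> pww] st].
  have [p [q [-> lp pq]]] := IH pww st.
  by exists (a :: p), q; rewrite /= las.
by exists [::], w.
Qed.

Lemma pw_split_tail s t p q : letters s p -> pw s t (p ++ s :: q) -> pw s.+1 t q.
Proof.
elim: p => [|a p IH] /=; first by rewrite ltnn eqxx.
by case/andP=> -> lp; apply: IH.
Qed.

Lemma shift_id s m w : letters s w -> shift s m w = w.
Proof.
by move=> /allP lw; rewrite -[RHS]map_id; apply/eq_in_map => l /lw ->.
Qed.

Lemma index_shift s m w : index (s + m) (shift s m w) = index s w.
Proof.
have inj : injective (fun l => if l < s then l else l + m).
  by move=> a b; case: (ltnP a s); case: (ltnP b s); lia.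
by have := index_map inj w s; rewrite ltnn.
Qed.

Lemma notin_letters s l w : letters s w -> s <= l -> l \notin w.
Proof. by move=> /allP lw sl; apply/negP => /lw; rewrite ltnNge sl. Qed.

Lemma take_index_notin (l : nat) w : l \notin w -> take (index l w) w = w.
Proof. by move/memNindex->; rewrite take_size. Qed.

Definition collapse s (w : seq nat) := [seq if l == s.+1 then s else l | l <- w].

Lemma letters_collapse s w : letters s.+2 w -> letters s.+1 (collapse s w).
Proof.
move=> /allP lw; apply/allP => _ /mapP[l /lw /= ll ->].
case: eqVneq => [_|ne]; first exact: ltnSn.
by rewrite ltn_neqAle ne -ltnS.
Qed.

Lemma letters_le s t w : s <= t -> letters s w -> letters t w.
Proof. by move=> st; apply: sub_all => l ls; apply: leq_trans ls st. Qed.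

(** The last line is chosen for a colouring by functions of the whole prefix, the other parameters
    for a colouring by functions of the letter put into that line. On the resulting cube the letters
    [s.+1] and [s] cannot be told apart. *)
Lemma shelah_cube s m (K : finType) : exists n, forall chi : seq nat -> K,
  exists F, [/\ size F = n, pw s.+2 (s.+2 + m) F & forall g, size g = m ->
    letters s.+2 g -> chi (wsubst s.+2 g F) = chi (wsubst s.+2 (collapse s g) F)].
Proof.
elim: m K => [|m IH] K.
  exists 0 => chi; exists [::]; split=> //=; by rewrite addn0.
have [n1 H1] := IH {ffun 'I_s.+2 -> K}.
have [n2 H2] := pigeonhole_line s {ffun n1.-tuple 'I_s.+2 -> K}.
exists (n1 + n2) => chi.
have [L [sL pL HL]] := H2 (fun w => encode_prefix s.+1 n1 (fun p => chi (p ++ w))).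
have [F [sF pF HF]] :=
  H1 (fun p => [ffun x : 'I_s.+2 => chi (p ++ wsubst s.+2 [:: val x] L)]).
have lF := pw_letters pF.
exists (F ++ shift s.+2 m L); split.
- by rewrite size_cat size_shift sF sL.
- exact: pw_cat pF (pw_line pL m).
move=> g; case/lastP: g => // g x; rewrite size_rcons => -[sg].
rewrite /letters all_rcons => /andP[xs lg].
have scg : size (collapse s g) = m by rewrite size_map.
rewrite /collapse map_rcons -/(collapse s g) -!cats1 !wsubst_cat.
rewrite !(wsubst_cat_letters _ _ lF) // !wsubst_shift_cat //.
have lcg : letters s.+2 (collapse s g).
  by apply: letters_le (letters_collapse lg).
have := HF _ sg lg => /(congr1 (fun f : {ffun 'I_s.+2 -> K} => f (Ordinal xs))).
rewrite !ffunE /= => ->; case: eqVneq => // ->.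
apply: (encode_prefix_eq HL); first by rewrite size_wsubst.
by apply: letters_wsubst; rewrite ?scg.
Qed.

Lemma hales_jewett s : hales_jewett_line s.+1.
Proof.
elim: s => [|s IH] K.
  exists 1 => chi; exists [:: 1]; split=> //.
  by move=> x y; rewrite !ltnS !leqn0 => /eqP-> /eqP->.
have [n1 H1] := IH K; have [n H] := shelah_cube s n1 K.
exists n => chi; have [F [sF pF HF]] := H chi.
have [L [sL pL HL]] := H1 (fun w => chi (wsubst s.+2 w F)).
have lF : letters (s.+2 + size (shift s.+1 1 L)) F.
  by rewrite size_shift sL; apply: pw_letters pF.
have pL1 : pw s.+2 s.+3 (shift s.+1 1 L) by move: (pw_line pL 1); rewrite addn1 addn2.
have E x : wsubst s.+2 [:: x] (shift s.+1 1 L) = wsubst s.+1 [:: x] L.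
  rewrite /wsubst /shift -map_comp; apply/eq_map => l /=.
  case: (ltnP l s.+1) => ls; first by rewrite ifT // ltnW.
  by rewrite ifF; [congr nth|]; lia.
(* [L] has no constant [s.+1], so collapsing its value at [s.+1] gives its value at [s]: the cube
   adds one letter to the monochromatic line. *)
have L0 x : x < s.+2 -> chi (wsubst s.+2 (wsubst s.+1 [:: x] L) F) =
                        chi (wsubst s.+2 (wsubst s.+1 [:: 0] L) F).
  rewrite ltnS leq_eqVlt => /orP[/eqP-> | xs]; last exact: HL.
  rewrite (HL 0 s) // HF; last 2 first.
  - by rewrite size_wsubst.
  - apply: letters_wsubst => //=; first by rewrite addn1; apply: pw_letters pL.
    by rewrite ltnSn.
  congr (chi (wsubst _ _ F)); rewrite /collapse /wsubst -map_comp.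
  have lL := pw_letters pL; apply/eq_in_map => l /(allP lL) /= ls.
  case: (ltnP l s.+1) => ll; first by case: eqP => // e; rewrite e ltnn in ll.
  have -> : l - s.+1 = 0 by move: ls ll; move: (l : nat) => {}l; lia.
  by rewrite /= eqxx.
exists (wsubst s.+2 (shift s.+1 1 L) F); split.
- by rewrite size_wsubst.
- apply: pw_wsubst pF _ pL1; by rewrite size_shift sL; lia.
- by move=> x y xs ys; rewrite !wsubst_sub // !E !L0.
Qed.

(* The colour of the part of F before its i-th parameter does not depend on
   the letters substituted for the earlier parameters. *)
Lemma prefix_hales_jewett s m (K : finType) : exists n,
  forall chi : seq nat -> K,
  exists F, [/\ size F = n, pw s.+1 (s.+1 + m) F & forall i, i <= m ->
    forall g g', size g = i -> size g' = i -> letters s.+1 g -> letters s.+1 g' ->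
    chi (wsubst s.+1 g (take (index (s.+1 + i) F) F)) =
    chi (wsubst s.+1 g' (take (index (s.+1 + i) F) F))].
Proof.
elim: m K => [|m IH] K.
  by exists 0 => chi; exists [::]; split=> //=; rewrite addn0.
have [n1 H1] := IH (K * K * K)%type.
have [n2 H2] := hales_jewett s {ffun n1.-tuple 'I_s.+1 -> K}.
exists (n1 + n2) => chi.
have [L [sL pL HL]] := H2 (fun w => encode_prefix s n1 (fun p => chi (p ++ w))).
pose kappa := take (index s.+1 L) L.
(* Three colourings at once: the prefix alone, continued up to the parameter of [L], and continued
   by [L] with 0 substituted. They serve i < m, i = m and i = m + 1. *)
have [F [sF pF HF]] := H1 (fun p =>
  (chi p, chi (p ++ kappa), chi (p ++ wsubst s.+1 [:: 0] L))).
have lF := pw_letters pF.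
have lk : letters s.+1 kappa by apply: pw_before pL _.
have pFL : pw s.+1 (s.+1 + m.+1) (F ++ shift s.+1 m L).
  exact: pw_cat pF (pw_line pL m).
exists (F ++ shift s.+1 m L); split=> //.
  by rewrite size_cat size_shift sF sL.
have nF : s.+1 + m \notin F by apply: notin_letters lF _.
move=> i; rewrite leq_eqVlt => /orP[/eqP-> | ]; last first.
  rewrite ltnS leq_eqVlt => /orP[/eqP-> | im].
    move=> g g' sg sg' lg lg'.
    have -> : take (index (s.+1 + m) (F ++ shift s.+1 m L)) (F ++ shift s.+1 m L)
            = F ++ kappa.
      rewrite index_cat (negbTE nF) index_shift take_cat ifF; last by rewrite ltnNge leq_addr.
      by rewrite addKn /shift -map_take -/(shift _ _ _) shift_id.
    have := HF m (leqnn m) g g' sg sg' lg lg'; rewrite take_index_notin //.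
    by case=> _ e _; rewrite !wsubst_cat !(wsubst_id _ lk).
  move=> g g' sg sg' lg lg'.
  have iF : s.+1 + i \in F by apply: pw_mem pF _; lia.
  rewrite index_cat iF take_cat index_mem iF.
  by have [] := HF i (ltnW im) g g' sg sg' lg lg'.
rewrite take_index_notin; last exact: notin_letters (pw_letters pFL) _.
have red g : size g = m.+1 -> letters s.+1 g -> exists2 h, size h = m /\ letters s.+1 h &
    chi (wsubst s.+1 g (F ++ shift s.+1 m L)) =
    chi (wsubst s.+1 h F ++ wsubst s.+1 [:: 0] L).
  case/lastP: g => // h x; rewrite size_rcons => -[sh].
  rewrite /letters all_rcons => /andP[xs lh]; exists h => //.
  rewrite -cats1 wsubst_cat (wsubst_cat_letters _ _ lF) // wsubst_shift_cat //.
  apply: (encode_prefix_eq (HL x 0 xs isT)); first by rewrite size_wsubst.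
  by apply: letters_wsubst; rewrite ?sh.
move=> g g' sg sg' lg lg'.
have [h [sh lh] ->] := red g sg lg; have [h' [sh' lh'] ->] := red g' sg' lg'.
have := HF m (leqnn m) h h' sh sh' lh lh'; rewrite take_index_notin //.
by case.
Qed.

(** * The Graham-Rothschild theorem, by induction on the number k of parameters *)

Definition graham_rothschild_for k := forall s m (K : finType), exists n,
  forall chi : seq nat -> K,
  exists F, [/\ size F = n, pw s.+1 (s.+1 + m) F & forall g g',
    size g = m -> size g' = m -> pw s.+1 (s.+1 + k) g -> pw s.+1 (s.+1 + k) g' ->
    chi (wsubst s.+1 g F) = chi (wsubst s.+1 g' F)].

Lemma graham_rothschild0 : graham_rothschild_for 0.
Proof.
move=> s m K; have [n H] := prefix_hales_jewett s m K; exists n => chi.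
have [F [sF pF HF]] := H chi; exists F; split=> // g g' sg sg'.
rewrite addn0 !pw_id => lg lg'.
(* The parameter [s.+1 + m] does not occur in [F], so the prefix before it is all of [F]. *)
have := HF m (leqnn m) g g' sg sg' lg lg'; rewrite take_index_notin //.
exact: notin_letters (pw_letters pF) _.
Qed.

(* Fusion: on a suitable subspace the colour of a word depends only on the
   part of it that precedes the first parameter. *)
Lemma fusion k : graham_rothschild_for k -> forall s m (K : finType), exists n,
  forall chi : seq nat -> K,
  exists F, [/\ size F = n, pw s.+1 (s.+1 + m) F & forall p q q',
    letters s.+1 p -> size (p ++ s.+1 :: q) = m -> size q' = size q ->
    pw s.+2 (s.+2 + k) q -> pw s.+2 (s.+2 + k) q' ->
    chi (wsubst s.+1 (p ++ s.+1 :: q) F) = chi (wsubst s.+1 (p ++ s.+1 :: q') F)].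
Proof.
move=> GR s; elim=> [|m IH] K.
  by exists 0 => chi; exists [::]; split=> //; rewrite addn0 /=.
(* Words starting with the first parameter are treated by [GR] with [s.+1] as one more constant,
   words starting with a constant x by induction on m, for all x at once. *)
have [m1 H1] := IH {ffun 'I_s.+1 -> K}; have [n1 H2] := GR s.+1 m1 K.
exists n1.+1 => chi.
have [G [sG pG HG]] := H2 (fun w => chi (s.+1 :: w)).
have [F [sF pF HF]] := H1 (fun w =>
  [ffun x : 'I_s.+1 => chi (val x :: wsubst s.+1 (val x :: w) G)]).
have lG : letters (s.+2 + size F) G by rewrite sF; apply: pw_letters pG.
have pF1 : pw s.+2 (s.+2 + m) (shift s.+1 1 F).
  by have := pw_shift 1 pF; rewrite addn1 addnAC addn1.
have comp x w : wsubst s.+1 (x :: w) (wsubst s.+2 (shift s.+1 1 F) G) =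
                wsubst s.+1 (x :: wsubst s.+1 w F) G.
  rewrite /wsubst -map_comp; apply/eq_in_map => l /(allP lG) /=.
  move: (l : nat) => {}l ll.
  case: (ltnP l s.+2) => ls2.
    by case: (ltnP l s.+1) => // ls1; have -> : l - s.+1 = 0 by lia.
  have -> : (l < s.+1) = false by lia.
  have -> : l - s.+1 = (l - s.+2).+1 by lia.
  rewrite /= /shift !(nth_map 0) /=; try by lia.
  case: (ltnP (nth 0 F (l - s.+2)) s.+1) => nF; first by rewrite nF.
  have -> : (nth 0 F (l - s.+2) + 1 < s.+1) = false by lia.
  by have -> : nth 0 F (l - s.+2) + 1 - s.+1 = (nth 0 F (l - s.+2) - s.+1).+1 by lia.
have head w : wsubst s.+1 (s.+1 :: w) G = wsubst s.+2 w G.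
  apply/eq_map => l; case: (ltnP l s.+1) => ls; first by rewrite ltnW.
  case: (ltnP l s.+2) => ls2.
    have -> : l - s.+1 = 0 by lia.
    by rewrite /=; lia.
  by have -> : l - s.+1 = (l - s.+2).+1 by lia.
have tail w : wsubst s.+1 w F = wsubst s.+2 w (shift s.+1 1 F).
  rewrite /wsubst /shift -map_comp; apply/eq_map => l /=.
  case: (ltnP l s.+1) => ls; first by rewrite ltnW.
  by rewrite addn1 ltnS ltnNge ls /= subSS.
exists (s.+1 :: wsubst s.+2 (shift s.+1 1 F) G); split.
- by rewrite /= size_wsubst sG.
- rewrite /= ltnn eqxx addnS -addSn /=; apply: pw_wsubst pG _ pF1.
  by rewrite size_shift sF addKn.
move=> [|x p] q q' /=.
  move=> _ [sq] sq' pq pq'; rewrite ltnn subnn /= !comp !head.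
  apply: HG; rewrite ?size_wsubst // tail; apply: pw_wsubst pF1 _ _ => //; lia.
case/andP=> xs lp [spq] sq' pq pq'; rewrite ltnn subnn /= !comp.
have := HF p q q' lp spq sq' pq pq'.
by move/(congr1 (fun f : {ffun 'I_s.+1 -> K} => f (Ordinal xs))); rewrite !ffunE.
Qed.

Lemma sum_count_mem (K : finType) (w : seq K) : \sum_x count_mem x w = size w.
Proof.
elim: w => [|a w IH] /=; first by rewrite big1.
rewrite big_split /= IH (bigD1 a) //= eqxx big1 // => b.
by rewrite eq_sym => /negbTE->.
Qed.

Lemma pigeonhole (K : finType) (c0 : K) m (w : seq K) :
  #|K| * m <= size w -> exists c, m <= count_mem c w.
Proof.
move=> sw; case: (boolP [exists c, m <= count_mem c w]) => [/existsP|] //.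
rewrite negb_exists => /forallP H; exists c0; case: m sw H => // m sw H.
have : \sum_x count_mem x w <= \sum_(x : K) m.
  by apply: leq_sum => x _; rewrite -ltnS ltnNge.
rewrite sum_count_mem sum_nat_const => /(leq_trans sw).
have K0 : 0 < #|K| by apply/card_gt0P; exists c0.
by rewrite leq_mul2l ltnn orbF; case: #|K| K0.
Qed.

(** Parameters go to the first m marked positions and 0 to all others; composing with this word
    discards the unwanted parameters. *)
Lemma pw_select s m (b : seq bool) : m <= count id b ->
  exists E, [/\ size E = size b, pw s.+1 (s.+1 + m) E
    & forall j, s < nth 0 E j -> nth false b j].
Proof.
suff gen c : s < c -> m <= count id b -> exists E, [/\ size E = size b,
    pw c (c + m) E & forall j, s < nth 0 E j -> nth false b j] by apply: gen.
elim: b m c => [|b0 b IH] m c sc /=.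
  rewrite leqn0 => /eqP->; exists [::]; rewrite /= addn0; split=> // j.
  by rewrite nth_nil.
case: b0 => /= mc; last first.
  have [E [sE pE HE]] := IH m c sc mc; exists (0 :: E); split=> /=.
  - by rewrite sE.
  - by rewrite (leq_trans _ sc).
  - by case=> //= j; apply: HE.
case: m mc => [_|m mc].
  have [E [sE pE HE]] := IH 0 c sc isT; exists (0 :: E); split=> /=.
  - by rewrite sE.
  - by rewrite (leq_trans _ sc).
  - by case=> //= j; apply: HE.
have [E [sE pE HE]] := IH m c.+1 (leqW sc) mc; exists (c :: E); split=> /=.
- by rewrite sE.
- by rewrite ltnn eqxx addnS -addSn.
- by case=> //= j; apply: HE.
Qed.

Lemma pw_size s t w : pw s t w -> t - s <= size w.
Proof.
elim: w s => [|l w IH] s /=; first by move/eqP->; rewrite subnn.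
case: ltnP => _; first by move/IH/leqW.
by case/andP=> _ /IH; lia.
Qed.

(** A representative of the words with k parameters: after fusion the colour no longer depends on
    the part behind the first parameter. *)
Definition canonical_word s k j : seq nat := iota s k ++ nseq (j - k) 0.

Lemma canonical_wordP s k q : 0 < s -> pw s (s + k) q ->
  size (canonical_word s k (size q)) = size q /\
  pw s (s + k) (canonical_word s k (size q)).
Proof.
move=> s0 /pw_size; rewrite addKn => kq; split.
  by rewrite size_cat size_iota size_nseq subnKC.
apply: (@pw_cat _ (s + k)).
  by elim: k s {s0 kq} => [|k IH] s /=; rewrite ?addn0 // ltnn eqxx addnS -addSn IH.
by rewrite pw_id letters_nseq // ltn_addr.
Qed.

Lemma graham_rothschild_aux k : graham_rothschild_for k.
Proof.
elim: k => [|k IH]; first exact: graham_rothschild0.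
move=> s m K.
(* Room for the pigeonhole principle: of [#|K| * m] parameters, m will share a colour. *)
have [M HM] := prefix_hales_jewett s (#|K| * m) K.
have [n Hn] := fusion IH s M K.
exists n => chi; have [F [sF pF HF]] := Hn chi.
pose q0 := canonical_word s.+2 k.
(* By fusion this is the colour of every word with k + 1 parameters whose part before the first one
   is [p]. *)
pose psi p := chi (wsubst s.+1 (p ++ s.+1 :: q0 (M - (size p).+1)) F).
have [H [sH pH HH]] := HM psi.
(* By [HH] the colour depends only on the parameter of [H] at which the prefix stops; [E] will keep
   m such parameters of one colour. *)
pose cs i := psi (wsubst s.+1 (nseq i 0) (take (index (s.+1 + i) H) H)).
pose w := [seq cs i | i <- iota 0 (#|K| * m)].
have [|c mc] := @pigeonhole K (cs 0) m w; first by rewrite size_map size_iota.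
have [E [sE pE HE]] : exists E, [/\ size E = #|K| * m, pw s.+1 (s.+1 + m) E
    & forall j, s < nth 0 E j -> j < #|K| * m -> cs j = c].
  have := @pw_select s m [seq x == c | x <- w].
  rewrite count_map => /(_ mc) [E [sE pE HE]]; exists E; split=> //.
    by rewrite sE !size_map size_iota.
  move=> j /HE; rewrite /w -map_comp => + js.
  by rewrite (nth_map 0) ?size_iota //= nth_iota // add0n => /eqP.
have lF := pw_letters pF; have lH := pw_letters pH.
suff mono g : size g = m -> pw s.+1 (s.+1 + k.+1) g ->
    chi (wsubst s.+1 g (wsubst s.+1 (wsubst s.+1 E H) F)) = c.
  exists (wsubst s.+1 (wsubst s.+1 E H) F); split; first by rewrite size_wsubst.
    apply: pw_wsubst pF _ _; first by rewrite size_wsubst sH addKn.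
    by apply: pw_wsubst pH _ pE; rewrite sE addKn.
  by move=> g g' sg sg' pg pg'; rewrite !mono.
move=> sg pg.
rewrite wsubst_sub ?size_wsubst ?sH // wsubst_sub ?sE //.
set g1 := wsubst s.+1 g E.
have pg1 : pw s.+1 (s.+1 + k.+1) g1 by apply: pw_wsubst pE _ pg; rewrite addKn.
have pg2 : pw s.+1 (s.+1 + k.+1) (wsubst s.+1 g1 H).
  by apply: pw_wsubst pH _ pg1; rewrite size_wsubst sE addKn.
have [|p1 [q1 [g1E lp1 pq1]]] := pw_split pg1; first by lia.
have sg1 : size g1 = #|K| * m by rewrite size_wsubst.
have p1K : size p1 < #|K| * m by rewrite -sg1 g1E size_cat /=; lia.
(* The first parameter of [g1] cannot come from a constant of [E], hence sits at a selected
   position. *)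
have csi : cs (size p1) = c.
  apply: HE => //.
  have : nth 0 g1 (size p1) = s.+1 by rewrite g1E nth_cat ltnn subnn.
  rewrite (nth_map 0) ?sE //; case: ltnP => // ls e; move: ls; rewrite e; lia.
have mH : s.+1 + size p1 \in H by apply: pw_mem pH _; lia.
set i := index (s.+1 + size p1) H.
have lt := pw_before pH (leq_addr (size p1) s.+1).
have g2E : wsubst s.+1 g1 H =
    wsubst s.+1 p1 (take i H) ++ s.+1 :: wsubst s.+1 g1 (drop i.+1 H).
  rewrite -{1}(cat_take_drop i H) (drop_nth 0) ?index_mem // wsubst_cat.
  rewrite {1}g1E (wsubst_cat_letters _ _ lt) //=; congr (_ ++ _ :: _).
  rewrite [nth 0 H i]nth_index // ifF; last by rewrite ltnNge leq_addr.
  by rewrite g1E addKn nth_cat ltnn subnn.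
have lp2 : letters s.+1 (wsubst s.+1 p1 (take i H)) by apply: letters_wsubst.
set p2 := wsubst s.+1 p1 (take i H) in g2E lp2 *.
set q2 := wsubst s.+1 g1 (drop i.+1 H) in g2E *.
have pq2 : pw s.+2 (s.+2 + k) q2.
  by apply: (pw_split_tail lp2); rewrite -g2E addSnnS.
have spq : size (p2 ++ s.+1 :: q2) = M by rewrite -g2E size_wsubst.
have [sq0 pq0] := canonical_wordP (ltn0Sn _) pq2.
rewrite g2E (HF p2 q2 (q0 (size q2))) //.
have -> : size q2 = M - (size p2).+1 by rewrite -spq size_cat /= addnS subSS addKn.
rewrite -/(psi p2) -csi /cs; apply: HH => //; first exact: ltnW.
  by rewrite size_nseq.
exact: letters_nseq.
Qed.

Theorem graham_rothschild s k m (K : finType) : exists n,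
  forall chi : seq nat -> K,
  exists F c, [/\ size F = n, pw s.+1 (s.+1 + m) F & forall g,
    size g = m -> pw s.+1 (s.+1 + k) g -> chi (wsubst s.+1 g F) = c].
Proof.
have [n H] := graham_rothschild_aux k s m K; exists n => chi.
have [F [sF pF HF]] := H chi.
exists F, (chi (wsubst s.+1 (canonical_word s.+1 k m) F)); split=> // g sg pg.
by have [] := canonical_wordP (ltn0Sn _) pg; rewrite sg => ? ?; apply: HF.
Qed.

(** * The colexicographic order on finite sets, coded by binary sums *)

Section BinarySums.
Variables (Z : finType) (e : Z -> nat).
Hypothesis e_inj : injective e.

Definition bsum (S : {set Z}) : nat := \sum_(z in S) 2 ^ e z.

Definition colex (S S' : {set Z}) : Prop :=
  exists2 z, (z \in S') && (z \notin S)
    & forall y, e z < e y -> (y \in S) = (y \in S').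

Lemma bsum_low m (P : pred Z) : (forall y, P y -> e y < m) ->
  \sum_(z | P z) 2 ^ e z < 2 ^ m.
Proof.
elim: m P => [|m IH] P low.
  by rewrite big_pred0 // => y; apply/negP => /low.
have [/existsP[z /andP[Pz /eqP ez]]|] := boolP [exists z, P z && (e z == m)].
  rewrite (bigD1 z) //= ez expnS mul2n -addnn ltn_add2l; apply: IH => y.
  case/andP=> /low; rewrite ltnS leq_eqVlt => /orP[/eqP ey|//].
  by rewrite -ez in ey; rewrite (e_inj ey) eqxx.
rewrite negb_exists => /forallP H.
apply: leq_trans (IH P _) _; last by rewrite leq_exp2l.
move=> y Py; have := low y Py; rewrite ltnS leq_eqVlt => /orP[ey|//].
by have := H y; rewrite Py ey.
Qed.

Lemma colex_ltn S S' : colex S S' -> bsum S < bsum S'.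
Proof.
case=> z /andP[zS' zS] H; rewrite /bsum.
rewrite (bigID (fun y => e z < e y)) [X in _ < X](bigID (fun y => e z < e y)) /=.
have -> : \sum_(y in S | e z < e y) 2 ^ e y = \sum_(y in S' | e z < e y) 2 ^ e y.
  by apply: eq_bigl => y; case: ltnP => [/H->|]; rewrite ?andbF.
rewrite ltn_add2l [X in _ < X](bigD1 z) /=; last by rewrite zS' ltnn.
apply: leq_trans (leq_addr _ _); apply: bsum_low => y /andP[yS].
rewrite -leqNgt leq_eqVlt => /orP[/eqP/e_inj yz|//].
by rewrite -yz yS in zS.
Qed.

Lemma colex_total S S' : S != S' -> colex S S' \/ colex S' S.
Proof.
move=> neq; pose D := [pred z | (z \in S) != (z \in S')].
have [z0 z0D] : exists z, D z.
  apply/existsP; apply: contraR neq; rewrite negb_exists => /forallP H.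
  by apply/eqP/setP => z; have := H z; rewrite negbK => /eqP.
case: (arg_maxnP e z0D) => z zD zmax.
have H y : e z < e y -> (y \in S) = (y \in S').
  by move=> lt; apply/eqP; apply: contraLR lt => ne; rewrite -leqNgt; apply: zmax.
move: zD; rewrite /D /=; case zS: (z \in S); case zS': (z \in S') => // _.
- by right; exists z; [rewrite zS zS' | move=> y /H].
- by left; exists z; [rewrite zS zS' | move=> y /H].
Qed.

Lemma bsum_inj : injective bsum.
Proof.
move=> S S' E; apply/eqP; apply: contra_eqT E.
by case/colex_total => /colex_ltn; lia.
Qed.

Lemma ltn_colex S S' : bsum S < bsum S' -> colex S S'.
Proof.
move=> lt; have neq : S != S' by apply: contraTneq lt => ->; rewrite ltnn.
by case: (colex_total neq) => // /colex_ltn; lia.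
Qed.

End BinarySums.

Lemma ltn_mulD R a b a' b' : b < R -> b' < R ->
  (a * R + b < a' * R + b') = (a < a') || ((a == a') && (b < b')).
Proof.
move=> bR bR'; case: (ltngtP a a') => [lt|lt|->] /=; last by rewrite ltn_add2l.
  have : a.+1 * R <= a' * R by rewrite leq_mul2r lt orbT.
  by rewrite mulSn; lia.
have : a'.+1 * R <= a * R by rewrite leq_mul2r lt orbT.
by rewrite mulSn; lia.
Qed.

(** * Columns *)

(* The double cover of a metric space: [par] is the sheet of a point. *)
Record pspace := Pspace {
  pt :> finType;
  rho : pt -> pt -> nat;
  par : pt -> bool;
  rk : pt -> nat;
  rho_eq0 : forall p q, (rho p q == 0) = (p == q);
  rhoC : forall p q, rho p q = rho q p;
  rho_tri : forall p q r, rho p r <= rho p q + rho q r;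
  rho_par : forall p q, odd (rho p q) = par p (+) par q;
  rk_inj : injective rk
}.

Definition pembedding (X Y : pspace) (F : X -> Y) : Prop :=
  [/\ forall p q, rho (F p) (F q) = rho p q,
      forall p, par (F p) = par p
    & forall p q, rk p < rk q -> rk (F p) < rk (F q)].

Section Columns.
Variables (N : nat) (X : pspace).

Definition column := {ffun X -> 'I_N.+1}.

Definition lipschitz (c : column) : bool :=
  [forall p, odd (c p) == par p] &&
  [forall p, forall q, c p <= c q + rho p q].

Lemma lipschitzP (c : column) :
  reflect ((forall p, odd (c p) = par p) /\
           (forall p q, c p <= c q + rho p q)) (lipschitz c).
Proof.
apply: (iffP andP) => [[/forallP H1 /forallP H2]|[H1 H2]]; split.
- by move=> p; apply/eqP.
- by move=> p q; have /forallP := H2 p.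
- by apply/forallP => p; apply/eqP.
- by apply/forallP => p; apply/forallP.
Qed.

Lemma lipschitz_par c p : lipschitz c -> par p <= c p.
Proof.
by case/lipschitzP=> podd _; have := podd p; case: (par p) => //; case: (c p : nat).
Qed.

(* [p] is a generator when the value at [p] is not forced by the parity nor
   by the Lipschitz condition at the other points. *)
Definition generator (c : column) (p : X) : bool :=
  (par p < c p) && [forall q, (q != p) ==> (c q < c p + rho p q)].

(** The value counts first, then the rank of the point; the factor exceeds every rank. *)
Definition pos (z : X * 'I_N.+1) : nat :=
  z.2 * (\max_p rk (p : X)).+1 + rk z.1.

Definition generators (c : column) : {set X * 'I_N.+1} :=
  [set z | generator c z.1 && (c z.1 == z.2)].

Definition key (c : column) : nat := bsum pos (generators c).

Lemma ltn_pos z y :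
  (pos z < pos y) = (z.2 < y.2) || ((z.2 == y.2) && (rk z.1 < rk y.1)).
Proof. by rewrite ltn_mulD // ltnS leq_bigmax. Qed.

Lemma pos_inj : injective pos.
Proof.
move=> z y E; have := ltn_pos z y; have := ltn_pos y z.
rewrite E ltnn -val_eqE; case: z y E => [p h] [q k] _ /=; rewrite -val_eqE /=.
case: ltngtP => //= /val_inj-> ; case: ltngtP => //= /rk_inj -> //.
Qed.

Lemma rho_refl (p : X) : rho p p = 0.
Proof. by apply/eqP; rewrite rho_eq0. Qed.

Lemma rho_gt0 (p q : X) : p != q -> 0 < rho p q.
Proof. by rewrite -rho_eq0 lt0n. Qed.

(** Among the points towards which [c] rises from [p] at full slope, one with the highest value is a
    generator: a further rise would contradict maximality. *)
Lemma generator_above c p : lipschitz c -> c p != par p :> nat ->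
  exists2 g, generator c g & c p + rho p g <= c g.
Proof.
case/lipschitzP=> podd lip cp.
have p0 : c p + rho p p <= c p by rewrite rho_refl addn0.
case: (@arg_maxnP _ p (fun q => c p + rho p q <= c q) (fun q => c q) p0) => q pq qmax.
exists q => //; apply/andP; split.
  rewrite ltnNge; apply/negP => le; have [e|ne] := eqVneq p q.
    subst q; case/negP: cp; apply/eqP; have := podd p; move: le.
    by case: (par p); case: (c p : nat) => [|[|n]].
  have := rho_gt0 ne; have := rho_par p q; have := podd p.
  have : c p = 0 :> nat by move: (rho_gt0 ne); case: (par q) le; lia.
  by move=> c0; move: cp; rewrite c0; case: (par p).
apply/forallP => r; apply/implyP => rq; rewrite ltnNge; apply/negP => le.
have r0 : 0 < rho q r by apply: rho_gt0; rewrite eq_sym.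
have := qmax r; have := rho_tri p q r; lia.
Qed.

(** Each value of [c] is either the least one of its parity or descends with slope one from a
    generator. *)
Lemma generator_dominate c c' : lipschitz c -> lipschitz c' ->
  (forall g, generator c g -> c g <= c' g) -> forall p, c p <= c' p.
Proof.
move=> lc lc' H p; have /lipschitzP[_ lip'] := lc'.
have [->|/(generator_above lc) [g gg cg]] := eqVneq (c p : nat) (par p).
  exact: lipschitz_par.
have := H g gg; have := lip' g p; rewrite rhoC; lia.
Qed.

Lemma key_inj c c' : lipschitz c -> lipschitz c' -> key c = key c' -> c = c'.
Proof.
move=> lc lc' /(bsum_inj pos_inj)/setP E.
have G g : generator c g && generator c' g && (c g == c' g) \/
           ~~ generator c g && ~~ generator c' g.
  have := E (g, c g); have := E (g, c' g); rewrite !inE /= !eqxx !andbT.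
  case: (generator c g); case: (generator c' g) => //= H1 H2; last by right.
  by left; rewrite H1.
apply/ffunP => p; apply/val_inj/eqP; rewrite eqn_leq; apply/andP; split.
  apply: generator_dominate => // g gg.
  by case: (G g); rewrite gg //= => /andP[_ /eqP->].
apply: generator_dominate => // g gg.
by case: (G g); rewrite gg ?andbF //= => /andP[_ /eqP->].
Qed.

(** The position in this list is the letter that stands for the column. *)
Definition columns : seq column :=
  sort (fun c c' => key c <= key c') (enum lipschitz).

Lemma mem_columns c : (c \in columns) = lipschitz c.
Proof. by rewrite mem_sort mem_enum. Qed.

Lemma columns_uniq : uniq columns.
Proof. by rewrite sort_uniq enum_uniq. Qed.

Lemma key_nth c0 i j : i < j < size columns ->
  key (nth c0 columns i) < key (nth c0 columns j).
Proof.
case/andP=> ij js.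
have srt : sorted (fun c c' => key c <= key c') columns.
  by apply: sort_sorted => c c'; apply: leq_total.
have tr : transitive (fun c c' : column => key c <= key c').
  by move=> b a c; apply: leq_trans.
have iS := ltn_trans ij js.
rewrite ltn_neqAle (sorted_ltn_nth tr c0 srt) ?inE // andbT.
apply/eqP => /key_inj E.
have : nth c0 columns i = nth c0 columns j.
  by apply: E; rewrite -mem_columns mem_nth.
by move/eqP; rewrite nth_uniq ?columns_uniq //; lia.
Qed.

Lemma index_key c c' : c \in columns -> c' \in columns -> key c < key c' ->
  index c columns < index c' columns.
Proof.
move=> cc cc' lt; case: ltngtP => // [gt|eq].
  have := @key_nth c (index c' columns) (index c columns).
  by rewrite gt index_mem cc !nth_index // => /(_ isT); lia.
have : c = c' by rewrite -(nth_index c cc) eq nth_index.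
by move=> e; rewrite e ltnn in lt.
Qed.

End Columns.

(** * The cone extension of columns along an embedding *)

Section Extension.
Variables (N : nat) (N0 : 0 < N) (X Y : pspace) (F : X -> Y).
Hypothesis FE : pembedding F.

Definition restrict (C : column N Y) : column N X := [ffun p => C (F p)].

(** For a Lipschitz [c], the pointwise least Lipschitz extension: the upper envelope of the cones
    descending from the values of [c], cut off below by the parity. *)
Definition extend (c : column N X) : column N Y :=
  [ffun q => inord (maxn (par q) (\max_p (c p - rho (F p) q)))].

Let Frho p q : rho (F p) (F q) = rho p q. Proof. by case: FE. Qed.
Let Fpar p : par (F p) = par p. Proof. by case: FE. Qed.

Lemma pembedding_inj : injective F.
Proof. by move=> p q E; apply/eqP; rewrite -rho_eq0 -Frho E rho_refl. Qed.
Let Finj := pembedding_inj.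

Lemma lipschitz_restrict C : lipschitz C -> lipschitz (restrict C).
Proof.
case/lipschitzP=> H1 H2; apply/lipschitzP; split=> [p|p q]; rewrite !ffunE.
  by rewrite H1 Fpar.
by rewrite -Frho.
Qed.

Lemma extendE c q :
  extend c q = maxn (par q) (\max_p (c p - rho (F p) q)) :> nat.
Proof.
rewrite ffunE inordK // ltnS geq_max; apply/andP; split.
  by apply: leq_trans N0; case: (par q).
by apply/bigmax_leqP => p _; have := ltn_ord (c p); lia.
Qed.

Lemma extend_ge (c : column N X) p q : c p - rho (F p) q <= extend c q.
Proof.
by rewrite extendE leq_max; apply/orP; right; apply: (@leq_bigmax _ _ p).
Qed.

Lemma extend_ge_par (c : column N X) q : par q <= extend c q.
Proof. by rewrite extendE leq_maxl. Qed.

Lemma extend_le (c : column N X) q v : par q <= v -> (forall p, c p <= v + rho (F p) q) ->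
  extend c q <= v.
Proof.
move=> qv H; rewrite extendE geq_max qv; apply/bigmax_leqP => p _.
by have := H p; lia.
Qed.

Lemma lipschitz_extend c : lipschitz c -> lipschitz (extend c).
Proof.
case/lipschitzP=> podd lip; apply/lipschitzP; split=> [q|q r].
  rewrite extendE.
  (* Every term is 0 or has the parity of [q], hence so does the maximum; 0 gives way to [par q]. *)
  have : let v := \max_p (c p - rho (F p) q) in (v == 0) || (odd v == par q).
    apply: (big_ind (fun v => (v == 0) || (odd v == par q))) => //.
      by move=> a b; rewrite /maxn; case: ifP.
    move=> p _; have [le|lt] := leqP (rho (F p) q) (c p).
      by rewrite oddB // podd rho_par Fpar addbA addbb addFb eqxx orbT.
    by rewrite (eqP (_ : c p - rho (F p) q == 0)) // subn_eq0 ltnW.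
  rewrite /maxn; case/orP=> /eqP E.
    by rewrite E ltn0; case: (par q).
  by case: ifP => // _; case: (par q).
apply: extend_le => [|p].
  have := extend_ge_par c r; have := rho_par q r.
  case: (par q); case: (par r) => //=; first by lia.
  by case: (rho q r) => // n; lia.
by have := extend_ge c p r; have := rho_tri (F p) q r; lia.
Qed.

Lemma extendK c p : lipschitz c -> extend c (F p) = c p.
Proof.
move=> lc; have /lipschitzP[_ lip] := lc; apply/val_inj/eqP; rewrite eqn_leq; apply/andP; split.
  apply: extend_le => [|r]; last by rewrite Frho; apply: lip.
  by rewrite Fpar; apply: lipschitz_par.
by have := extend_ge c p (F p); rewrite rho_refl subn0.
Qed.

Lemma restrict_extend c : lipschitz c -> restrict (extend c) = c.
Proof. by move=> lc; apply/ffunP => p; rewrite ffunE extendK. Qed.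

Lemma generator_restrict C p : generator C (F p) -> generator (restrict C) p.
Proof.
case/andP=> H1 /forallP H2; apply/andP; rewrite !ffunE; split; first by rewrite -Fpar.
apply/forallP => q; rewrite !ffunE -Frho; apply/implyP => ne.
by have /implyP := H2 (F q); apply; rewrite (inj_eq Finj).
Qed.

Lemma generator_extend c q : lipschitz c ->
  generator (extend c) q <-> exists2 p, F p = q & generator c p.
Proof.
move=> lc; have /lipschitzP[podd lip] := lc; split.
  move=> gq; have [/andP[H1 /forallP H2]] := (gq, gq).
  have [p /eqP Fp] : exists p, F p == q.
    apply/existsP; rewrite -[X in is_true X]negbK negb_exists; apply/negP => /forallP nF.
    (* At a generator the bounds from all other points are strict, so off the image of [F] the value
       could be lowered by one, against minimality. *)
    have : extend c q <= (extend c q).-1.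
      apply: extend_le => [|p]; first by lia.
      have := H2 (F p); rewrite nF /= extendK // rhoC; lia.
    by lia.
  by exists p => //; rewrite -Fp in gq; rewrite -(restrict_extend lc); apply: generator_restrict.
case=> p <- /andP[H1 /forallP H2]; apply/andP; rewrite extendK // Fpar; split=> //.
apply/forallP => q'; apply/implyP => ne.
have r0 : 0 < rho (F p) q' by apply: rho_gt0; rewrite eq_sym.
rewrite -[X in _ < X]prednK; last by lia.
rewrite ltnS; apply: extend_le => [|p'].
  by case: (par q') => //=; lia.
have [->|ne'] := eqVneq p' p; first by lia.
have := H2 p'; rewrite ne' /=; have := rho_tri (F p) q' (F p'); rewrite Frho.
by rewrite (rhoC q'); lia.
Qed.

Definition push (z : X * 'I_N.+1) : Y * 'I_N.+1 := (F z.1, z.2).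

Lemma generators_extend c : lipschitz c ->
  generators (extend c) = [set push z | z in generators c].
Proof.
move=> lc; apply/setP => -[q h]; rewrite !inE /=; apply/idP/imsetP.
  case/andP=> /(generator_extend _ lc)[p <- gp]; rewrite extendK // => /eqP <-.
  by exists (p, c p); rewrite // inE /= gp eqxx.
case=> -[p k]; rewrite inE /= => /andP[gp /eqP ck] [-> ->].
by rewrite extendK // ck eqxx andbT; apply/generator_extend => //; exists p.
Qed.

Lemma push_pos z y : pos z < pos y -> pos (push z) < pos (push y).
Proof.
case: FE => _ _ mono; rewrite !ltn_pos /= => /orP[->//|/andP[-> /mono->]].
by rewrite orbT.
Qed.

Lemma push_inj : injective push.
Proof. by move=> [p h] [q k] [/Finj-> ->]. Qed.

Lemma key_extend c c' : lipschitz c -> lipschitz c' -> key c < key c' ->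
  key (extend c) < key (extend c').
Proof.
move=> lc lc' /(ltn_colex (@pos_inj N X)) [z /andP[zc' zc] H].
apply: (colex_ltn (@pos_inj N Y)); rewrite !generators_extend //.
exists (push z); first by rewrite !(mem_imset _ _ push_inj) zc' zc.
have posE u v : (pos (push u) < pos (push v)) = (pos u < pos v).
  apply/idP/idP; last exact: push_pos.
  case: (ltngtP (pos u) (pos v)) => // [/push_pos|/pos_inj->]; lia.
move=> y lt; have [/existsP[x /eqP xy]|] := boolP [exists x, push x == y].
  by rewrite -xy !(mem_imset _ _ push_inj); apply: H; rewrite -posE xy.
rewrite negb_exists => /forallP ny.
by apply/idP/idP => /imsetP[x _ yx]; have := ny x; rewrite yx eqxx.
Qed.

(* The cone extension is the key-minimal extension: any other extension has a
   generator off the image of F, and above the highest such generator both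
   sets of generators agree. *)
Lemma key_extend_min C : lipschitz C -> key (extend (restrict C)) <= key C.
Proof.
move=> lC; set c := restrict C; have lc : lipschitz c := lipschitz_restrict lC.
pose D := [pred q | generator C q && [forall p, F p != q]].
have [/existsP[q0 q0D]|] := boolP [exists q, D q]; last first.
  rewrite negb_exists => /forallP nD.
  suff -> : extend c = C by [].
  have /lipschitzP[_ lip] := lC.
  apply/ffunP => q; apply/val_inj/eqP; rewrite eqn_leq; apply/andP; split.
    apply: extend_le => [|p]; last by rewrite ffunE; apply: lip.
    exact: lipschitz_par.
  apply: generator_dominate => //; first exact: lipschitz_extend.
  move=> g gg; have := nD g; rewrite /D /= gg /= negb_forall => /existsP[p].
  by rewrite negbK => /eqP <-; rewrite extendK // ffunE.
apply: ltnW; apply: (colex_ltn (@pos_inj N Y)).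
case: (arg_maxnP (fun q => pos (q, C q)) q0D) => g /andP[gg /forallP gF] gmax.
exists (g, C g).
  rewrite !inE /= gg eqxx /= negb_and; apply/orP; left; apply/negP.
  by case/(generator_extend _ lc) => p Fp _; have := gF p; rewrite Fp eqxx.
case=> q h lt; rewrite !inE /=; apply/idP/idP => /andP[gq /eqP hE].
  have [p Fp gp] := (generator_extend _ lc).1 gq; subst q.
  rewrite extendK // ffunE in hE; rewrite hE eqxx andbT.
  apply: contraLR lt => nC; rewrite -leqNgt.
  have cp : C (F p) != par (F p) :> nat.
    by case/andP: gp; rewrite ffunE Fpar; lia.
  have [g' gg' le] := generator_above lC cp.
  have ne : F p != g' by apply: contraNneq nC => ->.
  have r0 := rho_gt0 ne.
  (* Were [g'] the image of some [p'], the restriction would rise from [p] to [p'] at full slope and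
     [p] would not be its generator. *)
  have Dg' : D g'.
    rewrite /D /= gg'; apply/forallP => p'; apply/eqP => Fp'; subst g'.
    case/andP: gp => _ /forallP/(_ p'); rewrite !ffunE.
    have -> : p' != p by apply: contraNneq ne => ->.
    by move=> /=; rewrite -Frho; lia.
  apply: leq_trans (gmax g' Dg'); apply: ltnW; rewrite ltn_pos /= -hE.
  by have -> : C (F p) < C g' by lia.
have Fq : [exists p, F p == q].
  apply: contraLR lt; rewrite negb_exists -leqNgt => nF.
  by rewrite -hE; apply: gmax; rewrite /D /= gq.
have [p /eqP Fp] := existsP Fq; subst q.
rewrite extendK // ffunE hE eqxx andbT; apply/generator_extend => //.
by exists p => //; apply: generator_restrict.
Qed.

End Extension.

Lemma pw_criterion s t w : s <= t -> letters t w ->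
  (forall l, s <= l < t -> l \in w) ->
  (forall i l, i < size w -> s <= l < nth 0 w i -> l \in take i w) ->
  pw s t w.
Proof.
elim: w s => [|a w IH] s st /=.
  move=> _ H _; rewrite eqn_leq st /= leqNgt; apply/negP => lt.
  by have := H s; rewrite leqnn lt in_nil => /(_ isT).
case/andP=> at_ lw occ before; case: ltnP => as_.
  apply: IH => // [l lst|i l iw lt].
    by have := occ l lst; rewrite inE => /orP[/eqP e|//]; lia.
  by have := before i.+1 l iw lt; rewrite inE => /orP[/eqP e|//]; lia.
have aE : a = s.
  apply/eqP; rewrite eqn_leq as_ andbT leqNgt; apply/negP => lt.
  by have := before 0 s isT; rewrite /= leqnn lt in_nil => /(_ isT).
rewrite aE eqxx /=; apply: IH => // [|l lst|i l iw lt].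
- by rewrite -aE.
- by have := occ l; rewrite inE aE => /(_ _)/orP[|/eqP e|//]; lia.
- by have := before i.+1 l iw; rewrite /= inE aE => /(_ _)/orP[|/eqP e|//]; lia.
Qed.

(** * Restriction of columns respects first occurrences *)

Section Rigidity.
Variables (N : nat) (N0 : 0 < N) (X Y : pspace) (F : X -> Y).
Hypothesis FE : pembedding F.

Definition restriction_word : seq nat :=
  [seq index (restrict F C) (columns N X) | C <- columns N Y].

(** The first column restricting to c is the cone extension of c, by [key_extend_min], and cone
    extension preserves the order of keys. *)
Lemma restriction_word_pw : pw 0 (size (columns N X)) restriction_word.
Proof.
pose c0 : column N X := [ffun=> ord0].
have ext l : l < size (columns N X) -> let c := nth c0 (columns N X) l in
    [/\ lipschitz c, extend F c \in columns N Y & restrict F (extend F c) = c].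
  move=> ls /=; have lc : lipschitz (nth c0 (columns N X) l).
    by rewrite -mem_columns mem_nth.
  by rewrite mem_columns restrict_extend // lipschitz_extend.
apply: pw_criterion => //.
- apply/allP => _ /mapP[C CY ->]; rewrite index_mem mem_columns.
  by apply: lipschitz_restrict => //; rewrite -mem_columns.
- move=> l /= ls; have [lc eC rC] := ext l ls.
  by apply/mapP; eexists; [exact: eC | rewrite rC index_uniq ?columns_uniq].
- move=> i l; rewrite size_map => iY.
  pose C0 : column N Y := [ffun=> ord0].
  rewrite (nth_map C0) //=; set C := nth C0 (columns N Y) i => ll.
  have CY : C \in columns N Y by rewrite mem_nth.
  have lC : lipschitz C by rewrite -mem_columns.
  have cX : restrict F C \in columns N X.
    by rewrite mem_columns lipschitz_restrict.
  have iX : index (restrict F C) (columns N X) < size (columns N X).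
    by rewrite index_mem.
  have [lc eC rC] := ext l (ltn_trans ll iX).
  set c := nth c0 (columns N X) l in lc eC rC.
  have klt : key (extend F c) < key C.
    apply: leq_trans (key_extend_min N0 FE lC); apply: key_extend => //.
      by rewrite -mem_columns.
    rewrite -(nth_index c0 cX); apply: key_nth; by rewrite ll iX.
  have idx := index_key eC CY klt.
  rewrite [in X in _ < X]/C index_uniq ?columns_uniq // in idx.
  rewrite /restriction_word -map_take; apply/mapP; exists (extend F c).
    have -> : extend F c = nth C0 (take i (columns N Y)) (index (extend F c) (columns N Y)).
      by rewrite nth_take // nth_index.
    by apply: mem_nth; rewrite size_take iY.
  by rewrite rC index_uniq ?columns_uniq // (ltn_trans ll iX).
Qed.

End Rigidity.

(** * Columns that recover the distance and the order *)

Section SpecialColumns.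
Variables (N : nat) (X : pspace).

Definition base_column : column N X := [ffun p => inord (par p)].

(** For even [p0] its only generator is [p0] with value 2, so its place in the list reflects the
    rank of [p0]; it will detect the order. *)
Definition peak_column (p0 : X) : column N X :=
  [ffun p => inord (if p == p0 then 2 else par p)].

(** Attains the Lipschitz bound from [p0]; it will detect distances. *)
Definition cone_column (p0 : X) : column N X := [ffun p => inord (N - rho p0 p)].

Lemma par_le_rho (p q : X) : par p <= par q + rho p q.
Proof.
by have := rho_par p q; case: (par p); case: (par q) => //=; case: (rho p q).
Qed.

Lemma base_columnE p : 0 < N -> base_column p = par p :> nat.
Proof. by move=> N0; rewrite ffunE inordK //; case: (par p). Qed.

Lemma lipschitz_base : 0 < N -> lipschitz base_column.
Proof.
move=> N0; apply/lipschitzP; split=> [p|p q]; rewrite !base_columnE //.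
  by rewrite oddb.
exact: par_le_rho.
Qed.

Lemma key_base : 0 < N -> key base_column = 0.
Proof.
move=> N0; rewrite /key /bsum big_pred0 // => z; rewrite inE.
by rewrite /generator base_columnE // ltnn.
Qed.

Lemma nth_columns0 c0 : 0 < N ->
  0 < size (columns N X) /\ nth c0 (columns N X) 0 = base_column.
Proof.
move=> N0; have bc : base_column \in columns N X.
  by rewrite mem_columns lipschitz_base.
have s0 : 0 < size (columns N X) by case: (columns N X) bc.
split=> //; have [i0|i0] := posnP (index base_column (columns N X)).
  by rewrite -{1}i0 nth_index.
have := @key_nth N X c0 0 (index base_column (columns N X)).
by rewrite i0 index_mem bc nth_index // key_base // => /(_ isT).
Qed.

Lemma index_columns_gt0 (c : column N X) p : 0 < N -> lipschitz c -> c p != par p :> nat ->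
  0 < index c (columns N X) < size (columns N X).
Proof.
move=> N0 lc cp; have cc : c \in columns N X by rewrite mem_columns.
rewrite index_mem cc andbT lt0n; apply: contraNneq cp => i0.
have [_ E] := nth_columns0 c N0; rewrite -i0 nth_index // in E.
by rewrite E base_columnE.
Qed.

Lemma peak_columnE p0 p : 1 < N ->
  peak_column p0 p = (if p == p0 then 2 else par p) :> nat.
Proof. by move=> N1; rewrite ffunE inordK //; case: ifP => // _; case: (par p); lia. Qed.

Lemma lipschitz_peak p0 : 1 < N -> par p0 = false -> lipschitz (peak_column p0).
Proof.
move=> N1 par0; apply/lipschitzP; split=> [p|p q]; rewrite !peak_columnE //.
  by case: eqVneq => [->|_]; rewrite ?par0 ?oddb.
case: eqVneq => [->|_].
  case: eqVneq => [->|ne]; first by lia.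
  have r0 : 0 < rho p0 q by rewrite rho_gt0 // eq_sym.
  have := rho_par p0 q; rewrite par0; case: (par q) => /=; first by lia.
  by move: r0; case: (rho p0 q) => [|[|n]].
by case: eqVneq => _; [case: (par p) => //=; lia | exact: par_le_rho].
Qed.

Lemma key_peak p0 : 1 < N -> par p0 = false ->
  key (peak_column p0) = 2 ^ pos (p0, inord 2 : 'I_N.+1).
Proof.
move=> N1 par0; rewrite /key /bsum; have -> : generators (peak_column p0) = [set (p0, inord 2)].
  apply/setP => -[p h]; rewrite !inE xpair_eqE /=.
  have [->|ne] /= := eqVneq p p0; last first.
    by rewrite /generator peak_columnE // (negbTE ne) ltnn.
  rewrite ffunE eqxx eq_sym; case: (h == _); rewrite ?andbF // andbT.
  rewrite /generator peak_columnE // eqxx par0 /=; apply/forallP => q.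
  apply/implyP => qp; rewrite peak_columnE // (negbTE qp).
  by case: (par q) => //=; lia.
by rewrite big_set1.
Qed.

(** A smaller key leaves only generators of value 2 at even points of rank below [p0], and such a
    generator raises no value but its own. *)
Lemma before_peak p0 (C : column N X) q : 1 < N -> par p0 = false -> lipschitz C ->
  key C < key (peak_column p0) -> (forall g, par g = false -> rk g < rk p0 -> g != q) ->
  C q = par q :> nat.
Proof.
move=> N1 par0 lC lt far; apply/eqP; apply: contraT => Cq.
have [g gg le] := generator_above lC Cq.
have gC : (g, C g) \in generators C by rewrite inE /= gg eqxx.
have : 2 ^ pos (g, C g) < 2 ^ pos (p0, inord 2 : 'I_N.+1).
  rewrite -key_peak //; apply: leq_ltn_trans lt.
  by rewrite /key /bsum (bigD1 (g, C g)) //= leq_addr.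
rewrite ltn_exp2l // ltn_pos /= inordK; last by [].
have /lipschitzP[podd _] := lC.
have pq := lipschitz_par q lC.
have og := podd g; have oq := podd q; case/andP: gg => gpar _.
have gq : C g = 2 :> nat -> par g = false -> g = q.
  move=> Cg pg; apply/esym/eqP; rewrite -rho_eq0; have := rho_par q g.
  by move: Cq oq le; rewrite Cg pg; case: (par q) => /=; case: (C q : nat) => [|[|[|]]] //=; lia.
case/orP=> [C2|/andP[/eqP C2 rkg]].
  by move: gpar og; case: (par g); move: C2; case: (C g : nat) => [|[|[|]]].
have Cg : C g = 2 :> nat by rewrite C2 inordK.
have pg : par g = false by rewrite -og Cg.
by have := far g pg rkg; rewrite gq // eqxx.
Qed.

Lemma cone_columnE p0 p : cone_column p0 p = N - rho p0 p :> nat.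
Proof. by rewrite ffunE inordK // ltnS leq_subr. Qed.

Lemma lipschitz_cone p0 : ~~ odd N -> (forall p, rho p0 p <= N) ->
  par p0 = false -> lipschitz (cone_column p0).
Proof.
move=> oN bound par0; apply/lipschitzP; split=> [p|p q]; rewrite !cone_columnE.
  by rewrite oddB // (negbTE oN) rho_par par0.
have := rho_tri p0 p q; have := bound p; have := bound q; lia.
Qed.

End SpecialColumns.

(** * Graded distances *)

(* The length of a shortest walk of parity [e] between points at distance [d]
   that is compatible with odd closed walks of length at least 2 K1 + 1. *)
Definition graded (K1 d : nat) (e : bool) : nat :=
  if odd d == e then d else maxn d.+1 (2 * K1 + 1 - d).

Lemma odd_graded K1 d e : odd (graded K1 d e) = e.
Proof.
rewrite /graded; case: eqP => // /eqP; case: e; case E: (odd d) => //= _; lia.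
Qed.

Lemma graded_ge K1 d e : d <= graded K1 d e.
Proof. by rewrite /graded; case: ifP => // _; lia. Qed.

Lemma graded_odd K1 d : graded K1 d (odd d) = d.
Proof. by rewrite /graded eqxx. Qed.

(** In the critical case b and c have the required parities and a has not: then a + b + c is odd,
    and the last hypothesis gives b + c >= 2 K1 + 1 - a. *)
Lemma graded_tri K1 a b c e e' : a <= b + c -> b <= a + c -> c <= a + b ->
  (odd (a + b + c) -> 2 * K1 + 1 <= a + b + c) ->
  graded K1 a (e (+) e') <= graded K1 b e + graded K1 c e'.
Proof.
move=> h1 h2 h3; rewrite !oddD /graded.
by case Ea: (odd a); case Eb: (odd b); case Ec: (odd c); case: e e' => [] [] /= H;
  try have {}H := H isT; lia.
Qed.

Lemma class_A_perimeter K1 (X : dist_struct) (x y z : X) : class_A K1 X ->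
  odd (dist x z + dist x y + dist y z) ->
  2 * K1 + 1 <= dist x z + dist x y + dist y z.
Proof.
case=> [[d0 dC tri] no] o.
have d00 (u : X) : dist u u = 0 by apply/d0.
have H (u v : X) : odd (dist u v + dist u v) -> False by rewrite oddD addbb.
have xy : x != y by apply/eqP => e; apply: (H x z); move: o; rewrite e d00 addn0.
have yz : y != z.
  by apply/eqP => e; apply: (H x z); move: o; rewrite -e d00 addn0.
have zx : z != x.
  by apply/eqP => e; apply: (H x y); move: o; rewrite e d00 add0n (dC y).
have := no x y z xy yz zx; rewrite /perimeter (dC z x); move: o.
have -> : dist x z + dist x y + dist y z = dist x y + dist y z + dist x z by lia.
by move=> o H'; rewrite leqNgt; apply/negP => lt; apply: H'.
Qed.

(** * The double cover of a member of the class *)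

Section Cover.
Variables (K1 : nat) (X : ord_struct).
Hypothesis hX : free_orderings (class_A K1) X.

Let metX : is_metric X. Proof. by case: hX => -[]. Qed.
Let dist0 (x : X) : dist x x = 0. Proof. by case: metX => d0 _ _; apply/d0. Qed.
Let distC (x y : X) : dist x y = dist y x. Proof. by case: metX. Qed.

Definition below (x : X) : nat := #|[set y | (y != x) && ord y x]|.

Lemma below_lt (x y : X) : x != y -> ord x y -> below x < below y.
Proof.
case: hX => _ [refl anti trans tot] ne xy; apply: proper_card.
apply/properP; split.
  apply/subsetP => z; rewrite !inE => /andP[zx zx']; rewrite (trans x) // andbT.
  by apply: contraNneq zx => zy; subst z; apply/eqP/anti; rewrite zx'.
by exists x; rewrite !inE ?ne ?xy // eqxx.
Qed.

Lemma below_inj : injective below.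
Proof.
case: hX => _ [_ _ _ tot] x y E; apply/eqP; apply: contraT => ne.
case/orP: (tot x y) => /below_lt lt; first by have := lt ne; rewrite E ltnn.
by have := lt _; rewrite E ltnn eq_sym; apply.
Qed.

Definition cover_rho (p q : X * bool) : nat :=
  graded K1 (dist p.1 q.1) (p.2 (+) q.2).

Definition cover_rk (p : X * bool) : nat := below p.1 * 2 + p.2.

Lemma cover_rho_eq0 p q : (cover_rho p q == 0) = (p == q).
Proof.
case: p q => [x i] [y j]; rewrite xpair_eqE /cover_rho /=; apply/idP/idP.
  move=> /eqP E; have := odd_graded K1 (dist x y) (i (+) j); rewrite E.
  have := graded_ge K1 (dist x y) (i (+) j); rewrite E leqn0 => /eqP d0.
  have -> : x = y by case: metX => H _ _; apply/H.
  by case: i {E}; case: j => //=; rewrite eqxx.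
by case/andP=> /eqP-> /eqP->; rewrite dist0 addbb.
Qed.

Lemma cover_rhoC p q : cover_rho p q = cover_rho q p.
Proof. by rewrite /cover_rho distC addbC. Qed.

Lemma cover_rho_tri p q r : cover_rho p r <= cover_rho p q + cover_rho q r.
Proof.
rewrite /cover_rho.
have -> : p.2 (+) r.2 = (p.2 (+) q.2) (+) (q.2 (+) r.2).
  by case: p.2; case: q.2; case: r.2.
case: metX => _ _ tri; apply: graded_tri => //.
- by rewrite (distC q.1); apply: tri.
- by rewrite addnC (distC p.1 q.1); apply: tri.
- by apply: class_A_perimeter; case: hX.
Qed.

Lemma cover_rho_par p q : odd (cover_rho p q) = p.2 (+) q.2.
Proof. exact: odd_graded. Qed.

Lemma cover_rk_inj : injective cover_rk.
Proof.
move=> [x i] [y j]; rewrite /cover_rk /= => E.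
have : below x = below y by move: E; case: i; case: j => /=; lia.
by move=> /below_inj e; congr pair => //; move: E; rewrite e; case: i; case: j => /=; lia.
Qed.

Definition cover : pspace :=
  Pspace cover_rho_eq0 cover_rhoC cover_rho_tri cover_rho_par cover_rk_inj.

End Cover.

(** * The space of words *)

Section Words.
Variables (K1 n N : nat).

Definition word := {ffun 'I_n * bool -> 'I_N.+1}.

Definition absdiff a b := (a - b) + (b - a).

Lemma absdiff_le a b m : a <= b + m -> b <= a + m -> absdiff a b <= m.
Proof. by rewrite /absdiff; lia. Qed.

(** A word stores its values on both sheets; this is the sup distance between lifts of [w] and [w'],
    on opposite sheets when [e] holds. *)
Definition wrho (w w' : word) (e : bool) : nat :=
  \max_z absdiff (w z) (w' (z.1, z.2 (+) e)).

Lemma wrhoP (w w' : word) e m :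
  reflect (forall z, absdiff (w z) (w' (z.1, z.2 (+) e)) <= m) (wrho w w' e <= m).
Proof.
apply: (iffP idP) => [/bigmax_leqP H z|H]; first exact: H.
by apply/bigmax_leqP => z _; apply: H.
Qed.

Lemma wrho_ge (w w' : word) e z : absdiff (w z) (w' (z.1, z.2 (+) e)) <= wrho w w' e.
Proof. exact/wrhoP. Qed.

Lemma wrho_sym w w' e : wrho w w' e = wrho w' w e.
Proof.
have le v v' : wrho v v' e <= wrho v' v e.
  apply/wrhoP => z; have := wrho_ge v' v e (z.1, z.2 (+) e).
  by rewrite /= -addbA addbb addbF -surjective_pairing /absdiff addnC.
by apply/eqP; rewrite eqn_leq !le.
Qed.

Lemma wrho_tri w w' w'' e e' :
  wrho w w'' (e (+) e') <= wrho w w' e + wrho w' w'' e'.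
Proof.
apply/wrhoP => z; have := wrho_ge w w' e z.
have := wrho_ge w' w'' e' (z.1, z.2 (+) e); rewrite /= -addbA /absdiff; lia.
Qed.

Definition is_point (w : word) : bool :=
  [forall z, odd (w z) == z.2] && (2 * K1 + 1 <= wrho w w true).

Definition wpoint := {w : word | is_point w}.

Lemma odd_wrho (w w' : wpoint) e : odd (wrho (val w) (val w') e) = e.
Proof.
case: w w' => [w wP] [w' wP'] /=; case/andP: (wP) => /forallP ow wK.
case/andP: wP' => /forallP ow' _.
(* Without coordinates the two lifts of [w] would be at distance 0, below 2 K1 + 1. *)
have [t _] : exists t : 'I_n, True.
  have [|n0] := posnP n; last by exists (Ordinal n0).
  move=> n0; have : wrho w w true <= 0; last by lia.
  by apply/wrhoP => -[[t tn] i]; exfalso; rewrite n0 in tn.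
have par z : odd (absdiff (w z) (w' (z.1, z.2 (+) e))) = e.
  have := eqP (ow z); have := eqP (ow' (z.1, z.2 (+) e)); rewrite /absdiff /=.
  case: z.2; case: e => /= o1 o2; lia.
have : (wrho w w' e == 0) || (odd (wrho w w' e) == e).
  apply: (big_ind (fun v => (v == 0) || (odd v == e))) => //.
    by move=> a b; rewrite /maxn; case: ifP.
  by move=> z _; rewrite par eqxx orbT.
case/orP=> /eqP // E; have := wrho_ge w w' e (t, false); have := par (t, false).
by rewrite E leqn0 => o /eqP a0; rewrite a0 in o.
Qed.

Definition wdist (w w' : wpoint) : nat :=
  minn (wrho (val w) (val w') false) (wrho (val w) (val w') true).

Definition wspace : dist_struct := @DistStruct wpoint wdist.

Lemma wdistE w w' : wdist w w' = wrho (val w) (val w') (odd (wdist w w')).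
Proof.
have := odd_wrho w w' false; have := odd_wrho w w' true; rewrite /wdist /minn.
by case: ifP => _ o1 o2; rewrite ?o1 ?o2.
Qed.

Lemma wdist_le w w' e : wdist w w' <= wrho (val w) (val w') e.
Proof. by rewrite /wdist; case: e; rewrite geq_min leqnn ?orbT. Qed.

(** A triangle of odd perimeter through x lifts to a walk from one lift of x to the other, and
    [is_point] bounds its length below. *)
Lemma class_A_wspace : class_A K1 wspace.
Proof.
split; [split|] => /=.
- move=> x y; split=> [E|->].
    have := wdistE x y; rewrite E /= => /esym/eqP; rewrite -leqn0 => /wrhoP H.
    apply/val_inj/ffunP => z; apply/val_inj/eqP => /=.
    have := H z; rewrite addbF -surjective_pairing leqn0 addn_eq0 => /andP[].
    by rewrite !subn_eq0 => le1 le2; rewrite eqn_leq le1 le2.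
  apply/eqP; rewrite -leqn0; apply: leq_trans (wdist_le y y false) _.
  by apply/wrhoP => z; rewrite addbF -surjective_pairing /absdiff subnn.
- by move=> x y; rewrite /dist /= /wdist wrho_sym (wrho_sym _ _ true).
- move=> x y z; rewrite /dist /= (wdistE x y) (wdistE y z).
  exact: leq_trans (wdist_le _ _ _) (wrho_tri _ _ _ _ _).
- move=> x y z _ _ _ []; rewrite /perimeter /dist /=.
  case/andP: (valP x) => _ xK o lt; move: xK; rewrite leqNgt => /negP; apply.
  apply: leq_ltn_trans lt; rewrite -o !oddD.
  apply: leq_trans (wrho_tri _ (val z) _ _ _) _.
  rewrite -(wdistE z x) leq_add2r.
  apply: leq_trans (wrho_tri _ (val y) _ _ _) _.
  by rewrite -!wdistE.
Qed.

(** Earlier coordinates weigh more, then the sheet, then the letter. *)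
Definition wpos (z : ('I_n * bool) * 'I_N.+1) : nat :=
  ((n - z.1.1) * 2 + z.1.2) * N.+1 + z.2.

Lemma ltn_wpos z y : (wpos z < wpos y) =
  (y.1.1 < z.1.1) || ((z.1.1 == y.1.1) && ((z.1.2 < y.1.2) ||
    ((z.1.2 == y.1.2) && (z.2 < y.2)))).
Proof.
rewrite ltn_mulD ?ltn_ord // -val_eqE.
have := ltn_ord z.1.1; have := ltn_ord y.1.1.
by case: z.1.2; case: y.1.2 => /=; lia.
Qed.

Lemma wpos_inj : injective wpos.
Proof.
move=> z y E; have := ltn_wpos z y; have := ltn_wpos y z; rewrite E ltnn.
case: z y {E} => [[t i] a] [[t' i'] a'] /=; rewrite -!val_eqE /=.
case: ltngtP => //= /val_inj->; case: i; case: i' => //=; case: ltngtP => //= /val_inj-> //.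
Qed.

Definition wgraph (w : word) : {set ('I_n * bool) * 'I_N.+1} :=
  [set z | w z.1 == z.2].

Definition wcode (w : word) : nat := bsum wpos (wgraph w).

Lemma wcode_inj : injective wcode.
Proof.
move=> w w' /(bsum_inj wpos_inj)/setP E; apply/ffunP => z.
by have := E (z, w z); rewrite !inE /= eqxx => /esym/eqP.
Qed.

Lemma wcode_lt (w w' : word) (t : 'I_n) :
  (forall t' : 'I_n, t' < t -> forall i, w (t', i) = w' (t', i)) ->
  w (t, true) = w' (t, true) -> w' (t, false) < w (t, false) ->
  wcode w' < wcode w.
Proof.
move=> Hlt Ht lt; apply: (colex_ltn wpos_inj); exists ((t, false), w (t, false)).
  by rewrite !inE /= eqxx /= -val_eqE neq_ltn lt.
case=> -[t' i] a; rewrite ltn_wpos !inE /=.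
case/orP=> [/Hlt->//|/andP[/eqP <-]].
by case: i => [_|/=]; [rewrite Ht | move=> la; rewrite -!val_eqE /=; lia].
Qed.

(* Lexicographic order, larger letters first. *)
Definition word_space : ord_struct :=
  @OrdStruct wspace (fun w w' => wcode (val w') <= wcode (val w)).

Lemma word_space_free : free_orderings (class_A K1) word_space.
Proof.
split; first exact: class_A_wspace.
split=> /= [x|x y|y x z|x y]; rewrite /ord /=.
- exact: leqnn.
- by move=> H; apply/val_inj/wcode_inj/eqP; rewrite eqn_leq andbC.
- by move=> xy yz; apply: leq_trans yz xy.
- exact: leq_total.
Qed.

End Words.

(** * The Ramsey property *)

Section Spelling.
Variables (K1 n N : nat) (X : ord_struct).
Hypothesis hX : free_orderings (class_A K1) X.

Definition spell (u : seq nat) (x : X) : word n N :=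
  [ffun z : 'I_n * bool => nth (base_column N (cover hX)) (columns N (cover hX)) (nth 0 u z.1) (x, z.2)].

Variable u : seq nat.
Hypotheses (N1 : 1 < N) (N_even : ~~ odd N).
Hypothesis bound : forall p q : cover hX, rho p q <= N.
Hypotheses (size_u : size u = n) (pw_u : pw 1 (size (columns N (cover hX))) u).

Let N0 : 0 < N := ltnW N1.
Let col (l : nat) := nth (base_column N (cover hX)) (columns N (cover hX)) l.

Lemma spell_lipschitz (t : 'I_n) : lipschitz (col (nth 0 u t)).
Proof.
rewrite -mem_columns mem_nth //; have /allP lu := pw_letters pw_u.
by apply: lu; rewrite mem_nth // size_u.
Qed.

(** The base column is the letter 0, the only constant; every other column is a parameter of [u],
    and only smaller letters precede its first occurrence. *)
Lemma spell_occurs (c : column N (cover hX)) p : lipschitz c -> c p != par p :> nat ->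
  exists2 t : 'I_n, col (nth 0 u t) = c
    & forall t' : 'I_n, t' < t -> key (col (nth 0 u t')) < key c.
Proof.
move=> lc cp; have cc : c \in columns N (cover hX) by rewrite mem_columns.
have := index_columns_gt0 N0 lc cp; set l := index c _ => lP.
have lu : l \in u by apply: pw_mem pw_u lP.
have ln : index l u < n by rewrite -size_u index_mem.
exists (Ordinal ln) => /=; first by rewrite nth_index // /col nth_index.
move=> t' lt; rewrite -[c](nth_index (base_column N (cover hX)) cc) -/l -/(col l).
apply: key_nth; case/andP: lP => l0 ->; rewrite andbT.
have /allP := pw_before pw_u l0; apply.
rewrite -(nth_take 0 lt); apply: mem_nth.
by rewrite size_take index_mem lu.
Qed.

Lemma wrho_spell x y e : wrho (spell u x) (spell u y) e = graded K1 (dist x y) e.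
Proof.
have E : graded K1 (dist x y) e = @rho (cover hX) (x, false) (y, e) by [].
apply/eqP; rewrite eqn_leq; apply/andP; split.
  apply/wrhoP => -[t i]; rewrite !ffunE /=.
  have /lipschitzP[_ lip] := spell_lipschitz t.
  have r : @rho (cover hX) (x, i) (y, i (+) e) = graded K1 (dist x y) e.
    by rewrite /rho /= /cover_rho /= addbA addbb.
  apply: absdiff_le; rewrite -r; first exact: lip.
  by rewrite rhoC; apply: lip.
(* The cone at a lift of [x] attains the distance; even [N] gives it the right parity, and [bound]
   prevents truncation. *)
pose c := cone_column N ((x, false) : cover hX).
have lc : lipschitz c by apply: lipschitz_cone.
have [|t tc _] := spell_occurs lc (p := (x, false)).
  by rewrite cone_columnE rho_refl subn0 /=; lia.
have := wrho_ge (spell u x) (spell u y) e (t, false); rewrite !ffunE /=.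
rewrite -/(col _) tc !cone_columnE rho_refl E /absdiff.
have := bound (x, false) (y, e); lia.
Qed.

Lemma is_point_spell x : is_point K1 (spell u x).
Proof.
apply/andP; split.
  apply/forallP => -[t i]; rewrite ffunE /=.
  by have /lipschitzP[-> _] := spell_lipschitz t.
have -> : wrho (spell u x) (spell u x) true = graded K1 (dist x x) true.
  exact: wrho_spell.
have -> : dist x x = 0 by case: hX => -[[d0 _ _] _] _; apply/d0.
by rewrite /graded /=; lia.
Qed.

(** At the first occurrence of the peak at the smaller point [x] the letters are 2 and 0; earlier
    coordinates have smaller keys, so [x] and [y] agree there by [before_peak]. *)
Lemma spell_lt x y : x != y -> ord x y -> wcode (spell u y) < wcode (spell u x).
Proof.
move=> ne xy; pose p0 : cover hX := (x, false).
have par0 : par p0 = false by [].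
have lp := lipschitz_peak N1 par0.
have [|t tc tlt] := spell_occurs lp (p := p0); first by rewrite peak_columnE // eqxx.
have far (q : cover hX) : q.1 \in [:: x; y] ->
    forall g : cover hX, par g = false -> rk g < rk p0 -> g != q.
  case: q => [z i] zxy [z' j] /=; rewrite /par /= => -> lt.
  rewrite xpair_eqE negb_and; apply/orP; left; apply: contraTneq lt => ->.
  rewrite /cover_rk /= -leqNgt !addn0 leq_mul2r /=.
  move: zxy; rewrite !inE /= => /orP[/eqP->//|/eqP->].
  exact: ltnW (below_lt hX ne xy).
have low (q : cover hX) (t' : 'I_n) : q.1 \in [:: x; y] -> t' < t ->
    col (nth 0 u t') q = q.2 :> nat.
  move=> qxy /tlt lt; apply: (before_peak N1 par0 _ lt) (far q qxy).
  exact: spell_lipschitz.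
have yx : ((y, false) == p0 :> cover hX) = false.
  by rewrite xpair_eqE eq_sym (negbTE ne).
apply: (@wcode_lt _ _ _ _ t).
- move=> t' lt i; rewrite !ffunE /=; apply: val_inj.
  by rewrite -/(col _) /= !low // !inE eqxx ?orbT.
- rewrite !ffunE /= -/(col _) tc; apply: val_inj => /=.
  by rewrite !peak_columnE // !xpair_eqE !andbF.
- by rewrite !ffunE /= -/(col _) tc !peak_columnE // eqxx yx.
Qed.

Lemma spell_embedding : exists2 f : X -> word_space K1 n N,
  embedding f & forall x, val (f x) = spell u x.
Proof.
pose f x : word_space K1 n N := exist _ (spell u x) (is_point_spell x).
have fdist x y : dist (f x) (f y) = dist x y.
  rewrite -[LHS]/(wdist (f x) (f y)) /wdist /= !wrho_spell /minn.
  have := graded_odd K1 (dist x y); have := graded_ge K1 (dist x y) true.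
  have := graded_ge K1 (dist x y) false.
  by case: (odd _) => ? ? ?; case: ltnP; lia.
case: (hX) => -[[d0 _ _] _] [refl anti _ tot].
exists f => //; split=> //.
- by move=> x y e; apply/d0; rewrite -fdist e; case: (class_A_wspace K1 n N) => -[H _ _] _; apply/H.
- move=> x y; rewrite {1}/ord /=.
  have [->|ne] := eqVneq x y; first by rewrite leqnn refl.
  have [xy|yx] := boolP (ord x y); first exact: ltnW (spell_lt ne xy).
  have {}yx' : ord y x by have := tot x y; rewrite (negbTE yx).
  by rewrite leqNgt spell_lt // eq_sym.
Qed.

End Spelling.

Lemma cover_embedding K1 (A B : ord_struct) (hA : free_orderings (class_A K1) A)
    (hB : free_orderings (class_A K1) B) (f : A -> B) : embedding f ->
  @pembedding (cover hA) (cover hB) (fun p => (f p.1, p.2)).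
Proof.
case=> inj fd fo; split=> //.
  by move=> p q; rewrite /rho /= /cover_rho /= fd.
case=> [x i] [y j]; rewrite /rk /= /cover_rk /=.
have mono (x' y' : A) : below x' < below y' -> below (f x') < below (f y').
  case: (hA) => _ [_ _ _ tot] lt.
  have ne : x' != y' by apply: contraTneq lt => ->; rewrite ltnn.
  apply: (below_lt hB); first by rewrite (inj_eq inj).
  rewrite fo; case/orP: (tot x' y') => // yx.
  by have := below_lt hA _ yx; rewrite eq_sym ne => /(_ isT); lia.
case: (ltngtP (below x) (below y)) => [/mono|gt|/(below_inj hA)->].
- by case: i; case: j => /=; lia.
- by case: i; case: j => /=; lia.
- by case: i; case: j => /=; lia.
Qed.

Section Restriction.
Variables (K1 n N : nat) (A B : ord_struct).
Hypotheses (hA : free_orderings (class_A K1) A) (hB : free_orderings (class_A K1) B).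
Variables (f : A -> B) (fE : embedding f) (N0 : 0 < N).

Let F (p : cover hA) : cover hB := (f p.1, p.2).
Let FE : pembedding F := cover_embedding hA hB fE.

(** Base columns restrict to base columns, so the leading letter is 0; without it there remains a
    parameter word with the single constant 0. *)
Lemma restriction_word_head : exists2 v, restriction_word N F = 0 :: v
  & pw 1 (size (columns N (cover hA))) v.
Proof.
have := restriction_word_pw N0 FE.
have [s0 h0] := nth_columns0 (base_column N (cover hB)) N0.
have [s1 h1] := nth_columns0 (base_column N (cover hA)) N0.
have rb : restrict F (base_column N (cover hB)) = base_column N (cover hA).
  by apply/ffunP => p; rewrite !ffunE.
rewrite /restriction_word; case: (columns N (cover hB)) s0 h0 => //= C cs _ ->.
rewrite rb; case: (columns N (cover hA)) s1 h1 => //= c cs' _ ->.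
by rewrite eqxx /= => pv; eexists; first reflexivity.
Qed.

(** Turns copies of A inside the copy of B spelled by [u] into compositions of [u] with parameter
    words. *)
Lemma spell_restrict u v x : size u = n ->
  letters (size (columns N (cover hB))) u -> restriction_word N F = 0 :: v ->
  spell n N hA (wsubst 1 v u) x = spell n N hB u (f x).
Proof.
move=> su lu vE; apply/ffunP => -[t i]; rewrite !ffunE /=.
have tu : t < size u by rewrite su.
have lt : nth 0 u t < size (columns N (cover hB)).
  by have /allP := lu; apply; apply: mem_nth.
have -> : nth 0 (wsubst 1 v u) t = nth 0 (restriction_word N F) (nth 0 u t).
  by rewrite (nth_map 0) // vE; case: (nth 0 u t) => //= l; rewrite subn1.
rewrite (nth_map (base_column N (cover hB))) // nth_index; first by rewrite ffunE.
by rewrite mem_columns lipschitz_restrict // -mem_columns mem_nth.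
Qed.

End Restriction.

Lemma ramsey_free_orderings K1 : ramsey_class (free_orderings (class_A K1)).
Proof.
move=> A B hA hB k k0.
pose diam (X : pspace) := \max_(z : X * X) rho z.1 z.2.
(* Even, at least 2 and above all distances, as the cone and peak columns require. *)
pose N := (diam (cover hB)).+1.*2.
have N1 : 1 < N by rewrite /N; lia.
have N0 := ltnW N1.
have N_even : ~~ odd N by rewrite odd_double.
have diamP (X : pspace) (p q : X) : rho p q <= diam X.
  exact: (@leq_bigmax _ (fun z : X * X => rho z.1 z.2) (p, q)).
have boundB (p q : cover hB) : rho p q <= N.
  by apply: leq_trans (diamP _ p q) _; rewrite /N; lia.
have [sA _] := nth_columns0 (base_column N (cover hA)) N0.
have [sB _] := nth_columns0 (base_column N (cover hB)) N0.
set a := size (columns N (cover hA)) in sA.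
set b := size (columns N (cover hB)) in sB.
(* The letter 0 is the only constant; the columns other than the base column are the parameters. *)
have [n GR] := graham_rothschild 0 a.-1 b.-1 'I_k.
exists (word_space K1 n N); first exact: word_space_free.
move=> chi.
(* A word gets the colour of the set of points that it spells. *)
have [u [c [su pu Hu]]] := GR (fun v =>
  chi [set w | val w \in [seq spell n N hA v x | x : A]]).
rewrite add1n prednK // in pu.
have [h hE hval] := spell_embedding N1 N_even boundB su pu.
exists (h @: [set: B]); first by exists h.
exists c => SA [f' f'E SAE] SAB.
(* The copy of A is pulled back along [h] to an embedding of A into B. *)
have pre x : exists y, h y == f' x.
  have : f' x \in h @: [set: B] by apply: (subsetP SAB); rewrite SAE imset_f ?inE.
  by case/imsetP=> y _ ->; exists y.
pose f x := xchoose (pre x).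
have hf x : h (f x) = f' x by apply/eqP/(xchooseP (pre x)).
have fE : embedding f.
  case: hE f'E => hi hd ho [fi fd fo]; split=> [x y e|x y|x y].
  - by apply: fi; rewrite -!hf e.
  - by rewrite -hd !hf fd.
  - by rewrite -ho !hf fo.
have [v vE pv] := restriction_word_head hA hB fE N0.
have sv : size v = b.-1.
  by have := congr1 size vE; rewrite size_map /= /b => ->.
rewrite -(Hu v sv); last by rewrite add1n prednK.
congr chi; apply/setP => w; rewrite inE SAE.
have E x : val (f' x) = spell n N hA (wsubst 1 v u) x.
  by rewrite -hf hval (spell_restrict fE x su (pw_letters pu) vE).
apply/imsetP/mapP => [[x _ ->]|[x _ wE]].
  by exists x; rewrite ?mem_enum.
by exists x => //; apply: val_inj; rewrite E.
Qed.

(** * The expansion property *)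

Section Gadget.
Variables (K1 : nat) (A : dist_struct).
Hypothesis hA : class_A K1 A.

(** Exceeds all distances of A, and a triangle with a side [far] has perimeter at least 2 K1 + 1. *)
Definition far : nat := \max_(z : A * A) dist z.1 z.2 + 2 * K1 + 1.

(* For every ranking of A a copy of A ordered by it (the points with
   last component [false]), and after each of its points an inserted one. *)
Definition gadget_point : finType := (A * {ffun A -> 'I_#|A|.+1} * bool)%type.

Definition same_copy (p q : gadget_point) : bool :=
  [&& ~~ p.2, ~~ q.2 & p.1.2 == q.1.2].

Definition gadget_dist (p q : gadget_point) : nat :=
  if p == q then 0 else if same_copy p q then dist p.1.1 q.1.1 else far.

(** Lexicographic: the copy, the rank in it, an enumeration to break ties, the inserted point
    last. *)
Definition gadget_key (p : gadget_point) : nat :=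
  ((enum_rank p.1.2 * #|A|.+1 + p.1.2 p.1.1) * #|A|.+1 + enum_rank p.1.1) * 2 + p.2.

Definition gadget : ord_struct :=
  @OrdStruct (@DistStruct gadget_point gadget_dist)
    (fun p q => gadget_key p <= gadget_key q).

Lemma dist_lt_far (x y : A) : dist x y < far.
Proof.
rewrite /far addn1 ltnS; apply: leq_trans (leq_addr _ _).
exact: (@leq_bigmax _ (fun z : A * A => dist z.1 z.2) (x, y)).
Qed.

Lemma same_copyC p q : same_copy p q = same_copy q p.
Proof. by rewrite /same_copy eq_sym; case: p.2; case: q.2. Qed.

Lemma same_copy_trans q p r : same_copy p q -> same_copy q r -> same_copy p r.
Proof.
rewrite /same_copy => /and3P[-> _ /eqP->] /and3P[_ -> /eqP->].
by rewrite eqxx.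
Qed.

Lemma same_copy_neq p q : same_copy p q -> p != q -> p.1.1 != q.1.1.
Proof.
case: p q => [[x g] i] [[y g'] j]; rewrite /same_copy /=.
by case: i; case: j => //= /eqP->; apply: contraNneq => ->.
Qed.

Lemma gadget_distC p q : gadget_dist p q = gadget_dist q p.
Proof.
by case: hA => -[_ dC _] _; rewrite /gadget_dist eq_sym same_copyC (dC p.1.1).
Qed.

Lemma class_A_gadget : class_A K1 gadget.
Proof.
case: (hA) => -[d0 dC tri] no; split; [split|] => /=.
- move=> p q; rewrite /dist /= /gadget_dist; case: eqVneq => [->|ne]; first by split.
  split=> [|e]; last by rewrite e eqxx in ne.
  case: ifP => [/same_copy_neq/(_ ne) ne' /d0 e|_]; first by rewrite e eqxx in ne'.
  by rewrite /far; lia.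
- exact: gadget_distC.
- move=> p q r; rewrite /dist /= /gadget_dist.
  have [-> //|pr] := eqVneq p r; have [<-|pq] := eqVneq p q.
    by rewrite (negbTE pr).
  have [<-|qr] := eqVneq q r; first by rewrite addn0.
  case pqc: (same_copy p q); case qrc: (same_copy q r).
  + by rewrite (same_copy_trans pqc qrc).
  + by case: ifP => _; rewrite ?(leq_trans (ltnW (dist_lt_far _ _))) ?leq_addl.
  + by case: ifP => _; rewrite ?(leq_trans (ltnW (dist_lt_far _ _))) ?leq_addr.
  + by case: ifP => _; rewrite ?(leq_trans (ltnW (dist_lt_far _ _))) ?leq_addr.
- move=> p q r pq qr rp; rewrite /perimeter /dist /= /gadget_dist.
  rewrite (negbTE pq) (negbTE qr) (negbTE rp).
  case pqc: (same_copy p q); case qrc: (same_copy q r).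
  + have pr := same_copy_trans pqc qrc; have rpc := pr.
    rewrite same_copyC in rpc; rewrite rpc.
    by apply: no; apply: same_copy_neq.
  + case rpc: (same_copy r p); last by rewrite /far; lia.
    have := same_copy_trans rpc pqc; by rewrite same_copyC qrc.
  + case rpc: (same_copy r p); last by rewrite /far; lia.
    have := same_copy_trans qrc rpc; by rewrite same_copyC pqc.
  + by rewrite /far; lia.
Qed.

Lemma enum_rank_lt (x : A) : enum_rank x < #|A|.+1.
Proof. exact: leqW (ltn_ord _). Qed.

Lemma gadget_key_inj : injective gadget_key.
Proof.
have eqD R a b a' b' : b < R -> b' < R -> a * R + b = a' * R + b' -> a = a' /\ b = b'.
  move=> bR bR' E; have := ltn_mulD a a' bR bR'; have := ltn_mulD a' a bR' bR.
  by rewrite E ltnn; case: ltngtP => //= ->; case: ltngtP.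
case=> [[x g] i] [[y g'] j]; rewrite /gadget_key /=.
case/(eqD 2); [by case: i | by case: j |].
case/(eqD #|A|.+1); [exact: enum_rank_lt | exact: enum_rank_lt |].
case/(eqD #|A|.+1) => // /val_inj/enum_rank_inj-> _ /val_inj/enum_rank_inj->.
by case: i; case: j.
Qed.

Lemma gadget_free : free_orderings (class_A K1) gadget.
Proof.
split; first exact: class_A_gadget.
split=> /= [p|p q|q p r|p q]; rewrite /ord /=.
- exact: leqnn.
- by move=> H; apply/gadget_key_inj/eqP; rewrite eqn_leq.
- exact: leq_trans.
- exact: leq_total.
Qed.

Lemma gadget_key_mid x g : gadget_key (x, g, false) < gadget_key (x, g, true).
Proof. by rewrite /gadget_key /= addn0 addn1. Qed.

Lemma gadget_key_next x y (g : {ffun A -> 'I_#|A|.+1}) : g x < g y ->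
  gadget_key (x, g, true) < gadget_key (y, g, false).
Proof.
move=> lt; rewrite /gadget_key /= ltn_mulD // ltn_mulD ?enum_rank_lt //.
by rewrite ltn_add2l lt.
Qed.

Definition edge : ord_struct :=
  @OrdStruct (@DistStruct bool (fun a b => if a == b then 0 else far)) implb.

Lemma edge_free : free_orderings (class_A K1) edge.
Proof.
have far0 : 0 < far by rewrite /far addn1.
split; last by split=> [[]|[] []|[] [] []|[] []].
split; last by move=> [] [] [].
split=> /= [x y|x y|x y z]; rewrite /dist /=.
- by case: eqVneq => [->|ne]; split=> // e; [lia | rewrite e eqxx in ne].
- by rewrite eq_sym.
- by case: x; case: y; case: z => //=; rewrite ?leq_addr ?leq_addl.
Qed.

End Gadget.

Lemma expansion_free_orderings K1 :
  expansion_property (class_A K1) (free_orderings (class_A K1)).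
Proof.
move=> A hA.
have [C hC HC] := ramsey_free_orderings (edge_free K1 A) (gadget_free hA) (ltn0Sn 1).
exists (reduct C); first by case: hC.
move=> rA rB hrA hrB.
have [reflB antiB transB totB] : linear_order rB by case: hrB.
have [reflA _ _ totA] : linear_order rA by case: hrA.
(* A copy of [edge] has a single pair of points; its colour tells whether [rB] and the order of [C]
   agree on it. *)
pose agree (S : {set C}) := [exists p in S, exists q in S, [&& p != q, ord p q & rB p q]].
have [_ [h [hi hd ho] ->] [c Hc]] := HC (fun S => if agree S then ord_max else ord0).
have pair (p q : gadget K1 A) : gadget_dist K1 p q = far K1 A -> gadget_key p < gadget_key q ->
    agree [set h p; h q] = (c == ord_max).
  move=> d lt; have ne : p != q by apply: contraTneq lt => ->; rewrite ltnn.
  have <- : (if agree [set h p; h q] then ord_max else ord0) = c; last by case: ifP.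
  apply: Hc; last by apply/subsetP => w; rewrite !inE => /orP[/eqP->|/eqP->]; rewrite imset_f ?inE.
  exists (fun b : edge K1 A => if b then h q else h p).
    split=> [[] []|[] []|[] []] //=; rewrite ?hd ?ho //=.
    - by move/hi=> e; rewrite e eqxx in ne.
    - by move/hi=> e; rewrite e eqxx in ne.
    - by rewrite /dist /= /gadget_dist !eqxx.
    - by rewrite [LHS]gadget_distC.
    - by rewrite /dist /= /gadget_dist !eqxx.
    - by rewrite /ord /= leqnn.
    - by rewrite /ord /= leqNgt lt.
    - by rewrite /ord /= ltnW.
    - by rewrite /ord /= leqnn.
  apply/setP => w; rewrite !inE; apply/orP/imsetP => [[] /eqP->|[[] _ ->]].
  - by exists false.
  - by exists true.
  - by right.
  - by left.
have hne (p q : gadget K1 A) : gadget_key p < gadget_key q -> h p != h q.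
  by move=> lt; rewrite (inj_eq hi); apply: contraTneq lt => ->; rewrite ltnn.
have step (p q : gadget K1 A) : gadget_dist K1 p q = far K1 A -> gadget_key p < gadget_key q ->
    if c == ord_max then rB (h p) (h q) else rB (h q) (h p).
  move=> d lt; have ne := hne _ _ lt; have := pair p q d lt; case: eqP => _ ag.
    case/existsP: ag => u /andP[uS /existsP[v /andP[vS /and3P[uv ouv ruv]]]].
    move: uS vS uv ouv ruv; rewrite !inE.
    case/orP=> /eqP->; case/orP=> /eqP->; rewrite ?eqxx //.
    by rewrite ho /ord /= leqNgt lt.
  case/orP: (totB (h p) (h q)) => // r; case/negP: (negbT ag).
  apply/existsP; exists (h p); rewrite !inE eqxx /=; apply/existsP; exists (h q).
  by rewrite !inE eqxx orbT ne r ho /ord /= ltnW.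
have dmid (x : A) g : gadget_dist K1 (x, g, false) (x, g, true) = far K1 A.
  by rewrite /gadget_dist xpair_eqE andbF.
have dnext (x y : A) g : gadget_dist K1 (x, g, true) (y, g, false) = far K1 A.
  by rewrite /gadget_dist xpair_eqE andbF.
(* The point inserted after [x] is at distance [far] from both ends, so two steps and transitivity
   of [rB] compare the ends. *)
have chain (x y : A) (g : {ffun A -> 'I_#|A|.+1}) : g x < g y ->
    if c == ord_max then rB (h (x, g, false)) (h (y, g, false))
    else rB (h (y, g, false)) (h (x, g, false)).
  move=> lt; have := step _ _ (dmid x g) (gadget_key_mid x g).
  have := step _ _ (dnext x y g) (gadget_key_next lt).
  by case: ifP => _ r1 r2; [apply: transB r2 r1 | apply: transB r1 r2].
pose rank (x : A) := below (x : OrdStruct rA).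
have rank_le x : rank x <= #|A| by apply: max_card.
have [g gP] : exists g : {ffun A -> 'I_#|A|.+1}, forall x y, x != y -> rA x y ->
    rB (h (x, g, false)) (h (y, g, false)).
  have lt x y : x != y -> rA x y -> rank x < rank y by apply: (below_lt hrA).
  (* If [rB] agrees with [C] on such pairs, the copy of A ranked by [rA] is taken, otherwise the one
     ranked in reverse. *)
  have [cm|cm] := eqVneq c ord_max.
    exists [ffun x => inord (rank x)] => x y ne xy.
    have := @chain x y [ffun x => inord (rank x)].
    by rewrite !ffunE !inordK ?ltnS // cm eqxx; apply; apply: lt.
  exists [ffun x => inord (#|A| - rank x)] => x y ne xy.
  have := @chain y x [ffun x => inord (#|A| - rank x)].
  rewrite !ffunE !inordK ?ltnS ?leq_subr // (negbTE cm); apply.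
  by have := lt x y ne xy; have := rank_le y; lia.
exists (fun x => h (x, g, false)); split=> /=.
- by move=> x y /hi[].
- move=> x y; rewrite -[LHS]/(dist (h _) (h _)) hd /dist /= /gadget_dist.
  rewrite !xpair_eqE /same_copy /= !eqxx !andbT; case: eqVneq => // ->.
  by case: hA => -[d0 _ _] _; apply/esym/d0.
move=> x y; rewrite /ord /=; have [->|ne] := eqVneq x y; first by rewrite reflA reflB.
have [xy|yx] := boolP (rA x y); first exact: gP.
have {}yx : rA y x by have := totA x y; rewrite (negbTE yx).
apply/negP => r; have := gP y x; rewrite eq_sym ne yx => /(_ isT isT) r'.
have /antiB/hi[e] : rB (h (x, g, false)) (h (y, g, false)) && rB (h (y, g, false)) (h (x, g, false)).
  by rewrite r r'.
by rewrite e eqxx in ne.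
Qed.

Theorem theorem8p2 (K1 : nat) (hK1 : 1 <= K1) :
  ramsey_class (free_orderings (class_A K1)) /\
  expansion_property (class_A K1) (free_orderings (class_A K1)).
Proof.
split; [exact: ramsey_free_orderings | exact: expansion_free_orderings].
Qed.
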